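(* Let $\Theta:F^2(H_n)\otimes\mathcal E\to F^2(H_n)\otimes\mathcal E_*$ be a purely contractive (contractive) multi-analytic operator such that $$\overline{\Delta_\Theta(F^2(H_n)\otimes\mathcal E)}=\overline{\Delta_\Theta[(F^2(H_n)\otimes\mathcal E)\ominus\mathcal E]},$$ and let $\mathbf T=[\mathbf T_1,\ldots,\mathbf T_n]$ be the row contraction defined on the Hilbert space $$\mathbf H:=[(F^2(H_n)\otimes\mathcal E_* )\oplus\overline{\Delta_\Theta(F^2(H_n)\otimes\mathcal E)}]\ominus\{\Theta g\oplus\Delta_\Theta g:\ g\in F^2(H_n)\otimes\mathcal E\}$$ by $$\mathbf T_i^*(f\oplus u):=(S_i^*\otimes I_{\mathcal E_*})f\oplus C_i^*u,\qquad f\oplus u\in\mathbf H,\ i=1,\ldots,n,$$ where $C_i$ is the operator on $\overline{\Delta_\Theta(F^2(H_n)\otimes\mathcal E)}$ defined by $C_i(\Delta_\Theta g):=\Delta_\Theta(S_i\otimes I_{\mathcal E})g$, $g\in F^2(H_n)\otimes\mathcal E$. If $\mathbf H_1\subseteq\mathbf H$ is an invariant subspace under each operator $\mathbf T_i$, $i=1,\ldots,n$, then there is a regular factorization $\Theta=\Theta_2\Theta_1$, where $\Theta_1:F^2(H_n)\otimes\mathcal E\to F^2(H_n)\otimes\mathcal F$ and $\Theta_2:F^2(H_n)\otimes\mathcal F\to F^2(H_n)\otimes\mathcal E_*$ are contractive multi-analytic operators, such that the subspaces $\mathbf H_1$ and $\mathbf H_2:=\mathbf H\ominus\mathbf H_1$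 have the representations $$\mathbf H_1=\{\Theta_2f\oplus X_\Theta^*(\Delta_2f\oplus g):\ f\in F^2(H_n)\otimes\mathcal F,\ g\in\overline{\Delta_1(F^2(H_n)\otimes\mathcal E)}\}\ominus\{\Theta\varphi\oplus\Delta_\Theta\varphi:\ \varphi\in F^2(H_n)\otimes\mathcal E\}$$ and $$\mathbf H_2=\big[(F^2(H_n)\otimes\mathcal E_* )\oplus X_\Theta^*\big(\overline{\Delta_2(F^2(H_n)\otimes\mathcal F)}\oplus\{0\}\big)\big]\ominus\{\Theta_2f\oplus X_\Theta^*(\Delta_2f\oplus0):\ f\in F^2(H_n)\otimes\mathcal F\}.$$ Conversely, for every regular factorization $\Theta=\Theta_2\Theta_1$, with $\Theta_1:F^2(H_n)\otimes\mathcal E\to F^2(H_n)\otimes\mathcal F$ and $\Theta_2:F^2(H_n)\otimes\mathcal F\to F^2(H_n)\otimes\mathcal E_*$ contractive multi-analytic operators, the subspaces $$\mathbf H_1:=\{\Theta_2f\oplus X_\Theta^*(\Delta_2f\oplus g):\ f\in F^2(H_n)\otimes\mathcal F,\ g\in\overline{\Delta_1(F^2(H_n)\otimes\mathcal E)}\}\ominus\{\Theta\varphi\oplus\Delta_\Theta\varphi:\ \varphi\in F^2(H_n)\otimes\mathcal E\}$$ and $$\mathbf H_2:=\big[(F^2(H_n)\otimes\mathcal E_* )\oplus X_\Theta^*\big(\overline{\Delta_2(F^2(H_n)\otimes\mathcal F)}\oplus\{0\}\big)\big]\ominus\{\Theta_2f\oplus X_\Theta^*(\Delta_2f\oplus0):\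 f\in F^2(H_n)\otimes\mathcal F\}$$ have the following properties: (i) $\mathbf H_1$ is an invariant subspace under each operator $\mathbf T_i$, $i=1,\ldots,n$; (ii) $\mathbf H_2=\mathbf H\ominus\mathbf H_1$.
   Context: Conventions: $n\in\{1,2,\ldots\}$ or $n=\infty$; Hilbert spaces are complex, operators are bounded, subspaces are closed, infinite operator sums converge strongly. $H_n$ is an $n$-dimensional Hilbert space with orthonormal basis $e_1,e_2,\ldots$; $F^2(H_n)=\bigoplus_{k\ge0}H_n^{\otimes k}$ is the full Fock space ($H_n^{\otimes0}=\mathbb C1$), and $S_i\varphi=e_i\otimes\varphi$ are the left creation operators. A Hilbert space $\mathcal E$ is identified with $1\otimes\mathcal E\subset F^2(H_n)\otimes\mathcal E$. $[T_1,\ldots,T_n]$ is a row contraction if $\sum_iT_iT_i^*\le I$. A bounded operator $A:F^2(H_n)\otimes\mathcal K\to F^2(H_n)\otimes\mathcal K'$ is multi-analytic if $A(S_i\otimes I_{\mathcal K})=(S_i\otimes I_{\mathcal K'})A$ for all $i$. A contractive multi-analytic operator $\Theta:F^2(H_n)\otimes\mathcal E\to F^2(H_n)\otimes\mathcal E_*$ is purely contractive if $\|P_{\mathcal E_*}\Theta h\|<\|h\|$ for every nonzero $h\in\mathcal E$, where $P_{\mathcal E_*}$ is the orthogonal projection onto $1\otimes\mathcal E_*$. For contractive $\Theta$, $\Delta_\Theta=(I-\Theta^*\Theta)^{1/2}$. If $\Theta=\Theta_2\Theta_1$ with $\Theta_1:F^2(H_n)\otimes\mathcal E\to F^2(H_n)\otimes\mathcal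 F$, $\Theta_2:F^2(H_n)\otimes\mathcal F\to F^2(H_n)\otimes\mathcal E_*$ contractive multi-analytic, put $\Delta_j=(I-\Theta_j^*\Theta_j)^{1/2}$, $j=1,2$. The formula $X_\Theta(\Delta_\Theta f)=\Delta_2\Theta_1f\oplus\Delta_1f$ defines an isometry $X_\Theta:\overline{\Delta_\Theta(F^2(H_n)\otimes\mathcal E)}\to\overline{\Delta_2(F^2(H_n)\otimes\mathcal F)}\oplus\overline{\Delta_1(F^2(H_n)\otimes\mathcal E)}$ (depending on the factorization); the factorization is regular if $X_\Theta$ is unitary. *)

(* Defs.v *)
Set Warnings "-notation-overridden,-ambiguous-paths,-notation-incompatible-prefix".
Set Warnings "-redundant-canonical-projection,-projection-no-head-constant".
From HB Require Import structures.
From mathcomp Require Import all_boot all_order all_algebra.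
From mathcomp Require Import ring complex.
From mathcomp Require Import boolp classical_sets functions cardinality reals.
From mathcomp Require Import topology normedtype sequences.

Set Implicit Arguments.
Unset Strict Implicit.
Unset Printing Implicit Defensive.
Import Order.TTheory GRing.Theory Num.Theory.
Import numFieldNormedType.Exports.
Local Open Scope classical_set_scope.
Local Open Scope ring_scope.

(* Complex Hilbert spaces.  The norm of a normed module over R[i] takes values
   in R[i] (in its nonnegative reals); [inner] is linear in its first argument
   and antilinear in the second. *)
HB.mixin Record NormedModule_isHilbert (R : realType) V
    & CompleteNormedModule R[i] V := {
  inner : {dot V for @Num.conj R[i]};
  inner_norm : forall x : V, inner x x = `|x| ^+ 2
}.

#[short(type="hilbertType")]
HB.structure Definition Hilbert (R : realType) :=
  {V of NormedModule_isHilbert R V & CompleteNormedModule R[i] V}.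

Section dot_theory.
Variables (C : numClosedFieldType) (U : lmodType C) (form : {dot U for @Num.conj C}).
Local Notation "''[' u , v ]" := (form u v).
Local Notation "''[' u ]" := '[u, u].

Lemma dot_CauchySchwarz u v : `|'[u, v]| <= sqrtC '[u] * sqrtC '[v].
Proof.
have ge0 w : 0 <= '[w] by exact: dnorm_ge0.
rewrite -sqrtCM ?nnegrE// -[leLHS]sqrCK// ler_sqrtC ?nnegrE ?mulr_ge0 ?exprn_ge0//.
have [->|v0] := eqVneq v 0.
  by rewrite !linear0r normr0 expr0n/= mulr0.
have dv : 0 < '[v] by rewrite dnorm_gt0.
pose a := '[u, v] / '[v].
have aE : `|a| ^+ 2 * '[v] = `|'[u, v]| ^+ 2 / '[v].
  rewrite /a normrM normfV (gtr0_norm dv) exprMn -mulrA; congr (_ * _).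
  by rewrite expr2 -mulrA mulVf ?mulr1 ?gt_eqF.
have tE : '[u, a *: v] = `|'[u, v]| ^+ 2 / '[v].
  rewrite linearZr_LR /= /a rmorphM fmorphV /= [(_ v v)^*](CrealP _) ?gtr0_real//.
  by rewrite mulrAC [_^* * _]mulrC -normCK.
have tC : (`|'[u, v]| ^+ 2 / '[v])^* = `|'[u, v]| ^+ 2 / '[v].
  by apply/CrealP/ger0_real; rewrite divr_ge0 ?exprn_ge0.
have := ge0 (u - a *: v).
rewrite dnormB dnormZ tE tC aE opprD addrA addrK subr_ge0.
by rewrite ler_pdivrMr.
Qed.

Lemma dot_triangle u v : sqrtC '[u + v] <= sqrtC '[u] + sqrtC '[v].
Proof.
have ge0 w : 0 <= '[w] by exact: dnorm_ge0.
have s0 w : 0 <= sqrtC '[w] by rewrite sqrtC_ge0.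
rewrite -[leRHS](@sqrCK _ (sqrtC '[u] + sqrtC '[v])) ?addr_ge0//.
rewrite ler_sqrtC ?nnegrE ?exprn_ge0 ?addr_ge0//.
have dle : '[u, v] + '[u, v]^* <= (sqrtC '[u] * sqrtC '[v]) *+ 2.
  have -> : '[u, v] + '[u, v]^* = 'Re '[u, v] *+ 2.
    by rewrite ReE -mulr_natr divfK// pnatr_eq0.
  rewrite lerMn2r/=; apply: le_trans (dot_CauchySchwarz u v).
  exact: (leif_Re_Creal _).1.
by rewrite dnormD sqrrD !sqrtCK addrAC lerD2r lerD2l.
Qed.
End dot_theory.

(* Completeness is asked for Cauchy sequences only; the builder derives the
   filter version. *)
HB.factory Record Lmodule_isHilbert (R : realType) V
    & GRing.Lmodule R[i] V := {
  ip : V -> V -> R[i];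
  ip_scalar : forall y, scalar (ip^~ y);
  ip_conj : forall x y, ip x y = (ip y x)^*;
  ip_gt0 : forall x, x != 0 -> 0 < ip x x;
  ip_complete : forall u : nat -> V,
    (forall e : R[i], 0 < e -> exists N, forall m n, (N <= m)%N -> (N <= n)%N ->
       ip (u m - u n) (u m - u n) < e) ->
    exists l, forall e : R[i], 0 < e -> exists N, forall n, (N <= n)%N ->
       ip (u n - l) (u n - l) < e
}.

HB.builders Context R V & Lmodule_isHilbert R V.

Let ip_bilinear : bilinear_for *%R (@Num.conj R[i] \; *%R) ip.
Proof.
split=> [y|x] a u v; first exact: ip_scalar.
by rewrite ip_conj ip_scalar rmorphD rmorphM/= -!ip_conj.
Qed.

Let ip_herm x y : ip x y = (-1) ^+ false * (ip y x)^*.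
Proof. by rewrite mul1r -ip_conj. Qed.

HB.instance Definition _ := bilinear_isBilinear.Build R[i] V V R[i]
  *%R (@Num.conj R[i] \; *%R) ip ip_bilinear.
HB.instance Definition _ := isHermitianSesquilinear.Build R[i] V false
  (@Num.conj R[i]) ip ip_herm.
HB.instance Definition _ := isDotProduct.Build R[i] V ip ip_gt0.

Let form : {dot V for @Num.conj R[i]} := ip.
Let nrm (x : V) : R[i] := sqrtC (form x x).

Let nrmD x y : nrm (x + y) <= nrm x + nrm y.
Proof. exact: dot_triangle. Qed.

Let nrmZ (a : R[i]) x : nrm (a *: x) = `|a| * nrm x.
Proof.
by rewrite /nrm dnormZ sqrtCM ?nnegrE ?dnorm_ge0 ?exprn_ge0// sqrCK.
Qed.

Let nrm0 x : nrm x = 0 -> x = 0.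
Proof. by move=> /eqP; rewrite sqrt_dnorm_eq0 => /eqP. Qed.

HB.instance Definition _ := Lmodule_isNormed.Build R[i] V nrmD nrmZ nrm0.

Let form_norm (x : V) : form x x = `|x| ^+ 2.
Proof. by rewrite -[LHS]sqrtCK. Qed.

Let complete (F : set_system V) : ProperFilter F -> cauchy F -> cvg F.
Proof.
move=> FF /cauchyP FC.
have {}FC (k : nat) : {x : V | F (ball x (k.+1%:R^-1 : R[i]))}.
  by apply: cid; apply: FC; rewrite invr_gt0 ltr0n.
pose u k := sval (FC k).
have Fu k : F (ball (u k) (k.+1%:R^-1)) by exact: (svalP (FC k)).
have archi (e : R[i]) : 0 < e -> exists N, forall n, (N <= n)%N -> n.+1%:R^-1 < e.
  move=> e0; have eE : e = (complex.Re e)%:C%C by rewrite RRe_real// gtr0_real.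
  have e0' : 0 < complex.Re e by rewrite -ltcR -eE.
  exists (Num.truncn (complex.Re e)^-1) => n Nn.
  rewrite invf_plt ?posrE ?ltr0n//.
  rewrite eE -fmorphV -(rmorph_nat (real_complex R)) ltcR.
  by rewrite (lt_le_trans (truncnS_gt _))// ler_nat.
have dist m n : `|u m - u n| < m.+1%:R^-1 + n.+1%:R^-1.
  have [z []] := filter_ex (filterI (Fu m) (Fu n)).
  rewrite -!ball_normE/= => zm zn.
  rewrite -(subrK z (u m)) -addrA (le_lt_trans (ler_normD _ _))//.
  by rewrite ltrD// distrC.
have sq (x : V) (e : R[i]) : 0 < e -> (ip x x < e ^+ 2) = (`|x| < e).
  by move=> e0; rewrite form_norm ltr_pXn2r ?nnegrE ?normr_ge0 ?(ltW e0).
have [|l Hl] := ip_complete (u := u).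
  move=> e e0; have [N HN] := archi (sqrtC e / 2) (divr_gt0 (etrans (sqrtC_gt0 e) e0) (ltr0Sn _ 1)).
  exists N => m n Nm Nn; rewrite -[e]sqrtCK sq ?sqrtC_gt0//.
  by rewrite (lt_trans (dist m n))// [ltRHS]splitr ltrD// HN.
apply/cvg_ex; exists l; apply/fcvgrPdist_lt => e e0.
have e2 : 0 < e / 2 by rewrite divr_gt0.
have [N1 HN1] := archi _ e2.
have [N2 HN2] := Hl ((e / 2) ^+ 2) (exprn_gt0 _ e2).
pose N := maxn N1 N2.
have := Fu N; apply: filterS => y; rewrite -ball_normE/= => uy.
have : `|u N - l| < e / 2 by rewrite -sq// HN2 ?leq_maxr.
rewrite distrC => lu.
rewrite -(subrK (u N) l) -addrA (le_lt_trans (ler_normD _ _))//.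
by rewrite [ltRHS]splitr ltrD// (lt_trans uy)// HN1 ?leq_maxl.
Qed.

HB.instance Definition _ := Uniform_isComplete.Build V complete.
HB.instance Definition _ := NormedModule_isHilbert.Build R V form_norm.

HB.end.

Section hilbert_theory.
Variables (R : realType) (H : hilbertType R).
Implicit Types x y : H.

Lemma CauchySchwarz x y : `|inner x y| <= `|x| * `|y|.
Proof.
apply: le_trans (dot_CauchySchwarz inner x y) _.
by rewrite !inner_norm !sqrCK.
Qed.

Lemma inner_conj x y : inner x y = (inner y x)^*.
Proof. by rewrite hermitian_subproof mul1r. Qed.

Lemma inner_scalar y : scalar (fun x => inner x y).
Proof. by move=> a u v; rewrite linearPl. Qed.

Lemma inner_gt0 x : x != 0 -> 0 < inner x x.
Proof. exact: neq0_dnorm_gt0. Qed.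

Lemma inner_lt x (e : R[i]) : 0 < e -> (inner x x < e) = (`|x| < sqrtC e).
Proof.
move=> e0; rewrite inner_norm -{1}[e]sqrtCK ltr_pXn2r// nnegrE//.
by rewrite sqrtC_ge0 ltW.
Qed.

Lemma hilbert_complete (u : nat -> H) :
  (forall e : R[i], 0 < e -> exists N, forall m n, (N <= m)%N -> (N <= n)%N ->
     inner (u m - u n) (u m - u n) < e) ->
  exists l : H, (u n @[n --> \oo] --> l) /\
    forall e : R[i], 0 < e -> exists N, forall n, (N <= n)%N ->
     inner (u n - l) (u n - l) < e.
Proof.
move=> uC.
have /cauchy_cvg/cvg_ex[l ul] : cauchy (u n @[n --> \oo]).
  apply/cauchyP => e e0.
  have [N HN] := uC _ (exprn_gt0 2 e0).
  exists (u N); exists N => // n/= Nn; rewrite -ball_normE/=.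
  by rewrite -[ltRHS]sqrCK ?(ltW e0)// -inner_lt ?exprn_gt0// HN.
exists l; split => // e e0.
have /cvgrPdistC_lt/(_ (sqrtC e)) := ul.
rewrite sqrtC_gt0 => /(_ e0) [N _ HN].
by exists N => n Nn; rewrite inner_lt//; exact: HN.
Qed.

Lemma continuous_innerl y : continuous (fun x => inner x y).
Proof.
move=> x; apply/cvgrPdist_lt => e e0.
have y1 : 0 < `|y| + 1 by rewrite ltr_wpDl.
near=> z.
rewrite -linearBl/= (le_lt_trans (CauchySchwarz _ _))//.
rewrite (@le_lt_trans _ _ (`|x - z| * (`|y| + 1)))//.
  by rewrite ler_wpM2l// lerDl.
rewrite -ltr_pdivlMr//; near: z.
apply: (@cvgr_dist_lt _ _ _ (nbhs x) _ id x); first exact: cvg_id.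
by rewrite divr_gt0.
Unshelve. all: by end_near. Qed.

Definition closed_subspace (M : set H) : Prop :=
  [/\ M 0, forall (a : R[i]) x y, M x -> M y -> M (a *: x + y) & closed M].

Record subspace := Subspace {
  subspace_set :> set H;
  subspace_closed : closed_subspace subspace_set
}.

End hilbert_theory.

Definition in_subspace (R : realType) (H : hilbertType R) (M : subspace H) :
  {pred H} := mem (M : set H).

Record sub_of (R : realType) (H : hilbertType R) (M : subspace H) :=
  SubOf { incl : H; inclP : incl \in in_subspace M }.

Section sub_of.
Variables (R : realType) (H : hilbertType R) (M : subspace H).

HB.instance Definition _ := [isSub for @incl R H M].
HB.instance Definition _ := [Choice of sub_of M by <:].
Fact in_subspace_closed : submod_closed (in_subspace M).
Proof.
have [M0 MD _] := subspace_closed M; split; first exact: mem_set.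
by move=> a x y /set_mem Mx /set_mem My; apply: mem_set; exact: MD.
Qed.
HB.instance Definition _ := GRing.isSubmodClosed.Build R[i] H (in_subspace M)
  in_subspace_closed.
HB.instance Definition _ := [SubChoice_isSubLmodule of sub_of M by <:].

Lemma sub_incl (x : sub_of M) : (M : set H) (incl x).
Proof. by case: x => x /= /set_mem. Qed.

Let ip (x y : sub_of M) : R[i] := inner (incl x) (incl y).
Let ip_scalar y : scalar (ip^~ y).
Proof. by move=> a u v; exact: inner_scalar. Qed.
Let ip_conj x y : ip x y = (ip y x)^*.
Proof. exact: inner_conj. Qed.
Let ip_gt0 x : x != 0 -> 0 < ip x x.
Proof. by move=> x0; apply: inner_gt0; apply: contra x0 => /eqP x0; apply/eqP/val_inj. Qed.
Let ip_complete (u : nat -> sub_of M) :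
  (forall e : R[i], 0 < e -> exists N, forall m n, (N <= m)%N -> (N <= n)%N ->
     ip (u m - u n) (u m - u n) < e) ->
  exists l, forall e : R[i], 0 < e -> exists N, forall n, (N <= n)%N ->
     ip (u n - l) (u n - l) < e.
Proof.
move=> uC; have [l [ul Hl]] := @hilbert_complete R H (fun n => incl (u n)) uC.
have Ml : l \in (M : set H).
  have [_ _ Mc] := subspace_closed M; apply: mem_set.
  have Mu : \forall n \near \oo, (M : set H) (incl (u n)).
    by near=> n; exact: sub_incl.
  exact: (@closed_cvg nat H \oo _ (fun n => incl (u n)) (M : set H) Mc Mu l ul).
by exists (SubOf Ml).
Unshelve. all: by end_near. Qed.
HB.instance Definition _ := Lmodule_isHilbert.Build R (sub_of M)
  ip_scalar ip_conj ip_gt0 ip_complete.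
End sub_of.

(* Hilbert direct sum: not the product type, which carries the max norm. *)
Record hsum (R : realType) (H K : hilbertType R) :=
  HSum { hfst : H; hsnd : K }.

Section hsum.
Variables (R : realType) (H K : hilbertType R).
Local Notation S := (hsum H K).

Let to_pair (x : S) : H * K := (hfst x, hsnd x).
Let of_pair (p : H * K) : S := HSum p.1 p.2.
Let to_pairK : cancel to_pair of_pair. Proof. by case. Qed.
HB.instance Definition _ := Choice.copy S (can_type to_pairK).

Let zero : S := HSum 0 0.
Let opp (x : S) : S := HSum (- hfst x) (- hsnd x).
Let add (x y : S) : S := HSum (hfst x + hfst y) (hsnd x + hsnd y).
Let scale (a : R[i]) (x : S) : S := HSum (a *: hfst x) (a *: hsnd x).

Let addA : associative add.
Proof. by move=> x y z; rewrite /add !addrA. Qed.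
Let addC : commutative add.
Proof. by move=> x y; rewrite /add [hfst x + _]addrC [hsnd x + _]addrC. Qed.
Let add0 : left_id zero add.
Proof. by case=> x y; rewrite /add !add0r. Qed.
Let addN : left_inverse zero opp add.
Proof. by case=> x y; rewrite /add !addNr. Qed.
HB.instance Definition _ := GRing.isZmodule.Build S addA addC add0 addN.

Let scaleA a b x : scale a (scale b x) = scale (a * b) x.
Proof. by rewrite /scale !scalerA. Qed.
Let scale1 : left_id 1 scale.
Proof. by case=> x y; rewrite /scale !scale1r. Qed.
Let scaleDr : right_distributive scale +%R.
Proof. by move=> a x y; rewrite /scale !scalerDr. Qed.
Let scaleDl v : {morph scale^~ v : a b / a + b}.
Proof. by move=> a b; rewrite /scale !scalerDl. Qed.
HB.instance Definition _ :=
  GRing.Zmodule_isLmodule.Build R[i] S scaleA scale1 scaleDr scaleDl.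

Let ip (x y : S) : R[i] := inner (hfst x) (hfst y) + inner (hsnd x) (hsnd y).
Let ip_scalar y : scalar (ip^~ y).
Proof. by move=> a u v; rewrite /ip !inner_scalar mulrDr addrACA. Qed.
Let ip_conj x y : ip x y = (ip y x)^*.
Proof. by rewrite /ip rmorphD/= -!inner_conj. Qed.
Let ip_gt0 x : x != 0 -> 0 < ip x x.
Proof.
case: x => x y xy0; rewrite /ip/= !inner_norm.
have [x0|x0] := eqVneq x 0; last first.
  by rewrite ltr_wpDr ?exprn_ge0// exprn_gt0// normr_gt0.
have y0 : y != 0 by apply: contra xy0 => /eqP ->; rewrite x0.
by rewrite ltr_wpDl ?exprn_ge0// exprn_gt0// normr_gt0.
Qed.
Let ip_complete (u : nat -> S) :
  (forall e : R[i], 0 < e -> exists N, forall m n, (N <= m)%N -> (N <= n)%N ->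
     ip (u m - u n) (u m - u n) < e) ->
  exists l, forall e : R[i], 0 < e -> exists N, forall n, (N <= n)%N ->
     ip (u n - l) (u n - l) < e.
Proof.
move=> uC.
have [|x [_ Hx]] := @hilbert_complete R H (fun n => hfst (u n)).
  move=> e /uC[N HN]; exists N => m n Nm Nn; apply: le_lt_trans (HN m n Nm Nn).
  by rewrite /ip [in leRHS]inner_norm [inner (hsnd _) _]inner_norm -inner_norm lerDl exprn_ge0.
have [|y [_ Hy]] := @hilbert_complete R K (fun n => hsnd (u n)).
  move=> e /uC[N HN]; exists N => m n Nm Nn; apply: le_lt_trans (HN m n Nm Nn).
  by rewrite /ip [inner (hfst _) _]inner_norm lerDr exprn_ge0.
exists (HSum x y) => e e0; have e2 : 0 < e / 2 by rewrite divr_gt0.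
have [N1 HN1] := Hx _ e2; have [N2 HN2] := Hy _ e2.
exists (maxn N1 N2) => n; rewrite geq_max => /andP[nN1 nN2].
by rewrite [ltRHS]splitr /ip ltrD// ?HN1 ?HN2.
Qed.
HB.instance Definition _ := Lmodule_isHilbert.Build R S
  ip_scalar ip_conj ip_gt0 ip_complete.

End hsum.

(* The generic topology on numFieldType is not inferred for the concrete type
   R[i]. *)
#[non_forgetful_inheritance]
HB.instance Definition _ (R : realType) :=
  NormedModule.copy R[i] (R[i] : numFieldType)^o.

Section real_limits.
Variable R : realType.
Implicit Types u v : nat -> R[i].

Let cRe := @complex.Re R.

Lemma cvg_real_complex (v : nat -> R) (l : R) :
  v n @[n --> \oo] --> l -> (v n)%:C%C @[n --> \oo] --> l%:C%C.
Proof.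
move=> vl; apply/cvgrPdist_lt => e e0.
have eE : e = (cRe e)%:C%C by rewrite RRe_real// gtr0_real.
have e0' : 0 < cRe e by rewrite -ltcR -eE.
near=> n; rewrite -rmorphB/= normc_def/= expr0n/= addr0 sqrtr_sqr eE ltcR.
by near: n; move/cvgrPdist_lt: vl; exact.
Unshelve. all: by end_near. Qed.

Lemma cvg_Re u (l : R[i]) :
  u n @[n --> \oo] --> l -> cRe (u n) @[n --> \oo] --> cRe l.
Proof.
move=> ul; apply/cvgrPdist_lt => e e0.
have e0' : 0 < e%:C%C by rewrite -(rmorph0 (real_complex R)) ltcR.
near=> n.
have -> : cRe l - cRe (u n) = cRe (l - u n) by case: (l) (u n) => [? ?] [].
rewrite -ltcR (le_lt_trans (normc_ge_Re _))//.
by near: n; move/cvgrPdist_lt: ul; exact.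
Unshelve. all: by end_near. Qed.

Lemma lim_le_complex u (l c : R[i]) N : u n @[n --> \oo] --> l ->
  0 <= l -> 0 <= c -> (forall n, (N <= n)%N -> u n <= c) -> l <= c.
Proof.
move=> ul l0 c0 uc.
have lR := ger0_real l0; have cR := ger0_real c0.
rewrite -(RRe_real lR) -(RRe_real cR) lecR.
apply: (cvgr_to_le (cvg_Re ul)).
by exists N => // n /= Nn; have := uc n Nn; rewrite lecE => /andP[].
Qed.

Lemma nondecreasing_complex u (M : R[i]) :
  (forall n, 0 <= u n) -> {homo u : m n / (m <= n)%N >-> m <= n} ->
  (forall n, u n <= M) ->
  [/\ cvgn u, forall n, u n <= limn u &
      forall M, (forall n, u n <= M) -> limn u <= M].
Proof.
move=> u0 und uM.
have uE n : u n = (cRe (u n))%:C%C by rewrite RRe_real// ger0_real.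
have und' : {homo (fun n => cRe (u n)) : m n / (m <= n)%N >-> m <= n}.
  by move=> m n mn; rewrite -lecR -!uE und.
have uM' : has_ubound (range (fun n => cRe (u n))).
  exists (cRe M) => _ [n _ <-]; have := uM n; rewrite lecE => /andP[_].
  exact.
have cv := nondecreasing_is_cvgn und' uM'.
have ul : u n @[n --> \oo] --> (limn (fun n => cRe (u n)))%:C%C.
  by under eq_fun do rewrite uE; apply: cvg_real_complex.
have lE : limn u = (limn (fun n => cRe (u n)))%:C%C.
  by apply: cvg_lim.
split.
- by apply/cvg_ex; eexists; exact: ul.
- by move=> n; rewrite lE uE lecR; apply: nondecreasing_cvgn_le.
- move=> M' uM2; rewrite lE.
  have M0 : 0 <= M' := le_trans (u0 0%N) (uM2 0%N).
  rewrite -(RRe_real (ger0_real M0)) lecR; apply: limr_le => //.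
  by near=> n; have := uM2 n; rewrite lecE => /andP[].
Unshelve. all: by end_near. Qed.

End real_limits.

Lemma cvg_sum_seq (K : numFieldType) (V : normedModType K) (J : Type)
    (s : seq J) (u : J -> nat -> V) (l : J -> V) :
  (forall j, u j n @[n --> \oo] --> l j) ->
  \sum_(j <- s) u j n @[n --> \oo] --> \sum_(j <- s) l j.
Proof.
move=> ul; elim: s => [|j s IH].
  by under eq_fun do rewrite big_nil; rewrite big_nil; exact: cvg_cst.
under eq_fun do rewrite big_cons.
by rewrite big_cons; exact: (cvgD (ul j) IH).
Qed.

Lemma cvg_sqr (K : numFieldType) (u : nat -> K) (l : K) :
  u n @[n --> \oo] --> l -> u n ^+ 2 @[n --> \oo] --> l ^+ 2.
Proof.
by move=> ul; under eq_fun do rewrite expr2; rewrite expr2; exact: (cvgM ul ul).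
Qed.

Section ell2_def.
Variables (R : realType) (J : countType) (H : hilbertType R).

Definition square_summable (f : J -> H) : Prop :=
  exists M : R[i], forall s : seq J, uniq s -> \sum_(j <- s) `|f j| ^+ 2 <= M.

Definition ell2_pred : {pred J -> H} := mem [set f | square_summable f].

Record ell2 := Ell2 { ell2_fun :> J -> H; ell2P : ell2_fun \in ell2_pred }.

Lemma ell2_summable (f : ell2) : square_summable f.
Proof. by case: f => f /= /set_mem. Qed.

Fact ell2_pred_closed : submod_closed ell2_pred.
Proof.
split; first by apply: mem_set; exists 0 => s _; rewrite big1// => j _; rewrite normr0 expr0n.
move=> a f g /set_mem[M HM] /set_mem[N HN]; apply: mem_set.
exists ((`|a| ^+ 2 * M + N) *+ 2) => s us.
apply: (@le_trans _ _ ((`|a| ^+ 2 * \sum_(j <- s) `|f j| ^+ 2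
    + \sum_(j <- s) `|g j| ^+ 2) *+ 2)); last first.
  by rewrite lerMn2r/= lerD ?HN// ler_wpM2l ?exprn_ge0// HM.
rewrite mulr_sumr -big_split/= -sumrMnl ler_sum// => j _.
apply: (@le_trans _ _ ((`|a *: f j| + `|g j|) ^+ 2)).
  by rewrite lerXn2r ?nnegrE ?addr_ge0// ler_normD.
rewrite normrZ -exprMn.
rewrite -subr_ge0.
have -> : (((`|a| * `|f j|) ^+ 2 + `|g j| ^+ 2) *+ 2 - (`|a| * `|f j| + `|g j|) ^+ 2)
   = (`|a| * `|f j| - `|g j|) ^+ 2.
  by ring.
by rewrite -realEsqr realB ?realM ?ger0_real.
Qed.

HB.instance Definition _ := [isSub for ell2_fun].
HB.instance Definition _ := [Choice of ell2 by <:].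
HB.instance Definition _ :=
  GRing.isSubmodClosed.Build R[i] (J -> H) ell2_pred ell2_pred_closed.
HB.instance Definition _ := [SubChoice_isSubLmodule of ell2 by <:].

(* The elements of J whose code is smaller than n. *)
Definition initial (n : nat) : seq J := pmap (@pickle_inv J) (iota 0 n).

Lemma mem_initial n j : (j \in initial n) = (pickle j < n)%N.
Proof.
rewrite mem_pmap; apply/mapP/idP => [[k]|jn].
  rewrite mem_iota add0n => kn jE.
  have := @pickle_invK J k. by rewrite -jE /= => ->.
by exists (pickle j); rewrite ?mem_iota// pickleK_inv.
Qed.

Lemma initial_uniq n : uniq (initial n).
Proof.
exact: (pmap_uniq (@pickle_invK J) (iota_uniq 0 n)).
Qed.

Lemma initialS n : initial n.+1 = initial n ++ oapp (cons^~ [::]) [::] (@pickle_inv J n).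
Proof.
rewrite /initial -addn1 iotaD add0n pmap_cat/=.
by case: pickle_inv.
Qed.

(* The series converges absolutely, so its value does not depend on the
   enumeration of J. *)
Definition ell2_inner (f g : ell2) : R[i] :=
  limn (fun n => \sum_(j <- initial n) inner (f j) (g j)).

Lemma sum_initial_le (u : J -> R[i]) m n : (forall j, 0 <= u j) -> (m <= n)%N ->
  \sum_(j <- initial m) u j <= \sum_(j <- initial n) u j.
Proof.
move=> u0; elim: n => [|n IH]; first by rewrite leqn0 => /eqP ->.
rewrite leq_eqVlt => /predU1P[->//|]; rewrite ltnS => /IH /le_trans; apply.
rewrite initialS big_cat/= lerDl; case: pickle_inv => [j|] /=.
  by rewrite big_seq1.
by rewrite big_nil.
Qed.

Lemma normsq_cvg (f : J -> H) : square_summable f ->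
  let N := limn (fun n => \sum_(j <- initial n) `|f j| ^+ 2) in
  [/\ cvgn (fun n => \sum_(j <- initial n) `|f j| ^+ 2),
      forall s, uniq s -> \sum_(j <- s) `|f j| ^+ 2 <= N &
      forall M, (forall s, uniq s -> \sum_(j <- s) `|f j| ^+ 2 <= M) -> N <= M].
Proof.
move=> [M HM] N.
have [|m n mn|n|c le_lim lim_le] :=
    @nondecreasing_complex R (fun n => \sum_(j <- initial n) `|f j| ^+ 2) M.
- by move=> n; rewrite sumr_ge0// => j _; rewrite exprn_ge0.
- by apply: sum_initial_le => // j; rewrite exprn_ge0.
- exact/HM/initial_uniq.
split => // [s us|M' HM']; last by apply: lim_le => n; exact/HM'/initial_uniq.
pose n := \max_(j <- s) (pickle j).+1.
apply: le_trans (le_lim n).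
have sub : {subset s <= initial n}.
  move=> j js; rewrite mem_initial /n (big_rem j)//= leq_max leqnn.
  by [].
have P : perm_eq [seq j <- initial n | j \in s] s.
  apply: uniq_perm => //; first by rewrite filter_uniq// initial_uniq.
  move=> j; rewrite mem_filter; case: (boolP (j \in s)) => //= js.
  by rewrite sub.
rewrite [leRHS](bigID (mem s))/= -[X in _ <= X + _]big_filter.
by rewrite (perm_big _ P) lerDl sumr_ge0// => j _; rewrite exprn_ge0.
Qed.

Lemma polarization (x y : H) : inner x y = 4^-1 * (`|x + y| ^+ 2 - `|x - y| ^+ 2
   + 'i * `|x + 'i *: y| ^+ 2 - 'i * `|x - 'i *: y| ^+ 2).
Proof.
have E c : `|x + c *: y| ^+ 2 =
    inner x x + c^* * inner x y + c * inner y x + c * c^* * inner y y.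
  rewrite -inner_norm linearDl/= !linearDr/= !linearZl_LR/= !linearZr_LR/=.
  by ring.
have ii : 'i * 'i = -1 :> R[i] by rewrite -expr2 sqrCi.
have conjN (c : R[i]) : (- c)^* = - c^* by rewrite rmorphN.
have E1 := E 1; have E2 := E (-1); have E3 := E 'i; have E4 := E (- 'i).
rewrite scale1r conjC1 in E1; rewrite scaleN1r conjN conjC1 in E2.
rewrite conjCi in E3; rewrite scaleNr conjN conjCi in E4.
rewrite E1 E2 E3 E4.
have i4 : 4%:R != 0 :> R[i] by rewrite pnatr_eq0.
apply: (mulfI i4); rewrite mulVKf//.
have -> : 4 * inner x y = 2 * inner x y + 2 * inner y x
    - ('i * 'i) * (2 * inner x y) + ('i * 'i) * (2 * inner y x).
  by rewrite ii; ring.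
by ring.
Qed.

Lemma ell2_inner_cvg (f g : ell2) :
  cvgn (fun n => \sum_(j <- initial n) inner (f j) (g j)).
Proof.
pose N (h : ell2) n := \sum_(j <- initial n) `|h j| ^+ 2.
have Nc h : cvgn (N h) by have [] := normsq_cvg (ell2_summable h).
rewrite (_ : (fun n => _) = (fun n => 4^-1 * (N (f + g) n - N (f - g) n
   + 'i * N (f + 'i *: g) n - 'i * N (f - 'i *: g) n))).
  have cM c h : cvgn (fun n => c * N h n).
    by apply: is_cvgM; [exact: is_cvg_cst|exact: Nc].
  apply: is_cvgM; first exact: is_cvg_cst.
  apply: is_cvgB; last exact: cM.
  by apply: is_cvgD; [apply: is_cvgB; exact: Nc|exact: cM].
apply/funext => n; under eq_bigr do rewrite polarization.
rewrite -mulr_sumr; congr (_ * _).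
by rewrite /N !mulr_sumr -!sumrB -big_split/= -sumrB.
Qed.

Let ip_scalar (g : ell2) : scalar (fun f => ell2_inner f g).
Proof.
move=> a f h; rewrite /ell2_inner.
under [X in limn X = _]eq_fun => n.
  under eq_bigr do rewrite linearPl/=.
  rewrite big_split/= -mulr_sumr.
  over.
apply/cvg_lim => //; apply: cvgD; last exact: ell2_inner_cvg.
by apply: cvgM; [exact: cvg_cst|exact: ell2_inner_cvg].
Qed.

Lemma ell2_innerE (f : ell2) :
  ell2_inner f f = limn (fun n => \sum_(j <- initial n) `|f j| ^+ 2).
Proof. by congr (limn _); apply/funext => n; apply: eq_bigr => j _; rewrite inner_norm. Qed.

Lemma ell2_inner_ge (f : ell2) s : uniq s -> \sum_(j <- s) `|f j| ^+ 2 <= ell2_inner f f.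
Proof. by rewrite ell2_innerE; have [_ + _] := normsq_cvg (ell2_summable f); apply. Qed.

Lemma ell2_inner_le (f : ell2) M :
  (forall s, uniq s -> \sum_(j <- s) `|f j| ^+ 2 <= M) -> ell2_inner f f <= M.
Proof. by rewrite ell2_innerE; have [_ _] := normsq_cvg (ell2_summable f); apply. Qed.

Lemma ell2_coord_le (f : ell2) j : inner (f j) (f j) <= ell2_inner f f.
Proof.
by rewrite inner_norm -(big_seq1 +%R j (fun j => `|f j| ^+ 2)) ell2_inner_ge.
Qed.

Let ip_conj (f g : ell2) : ell2_inner f g = (ell2_inner g f)^*.
Proof.
apply/cvg_lim => //; rewrite /ell2_inner.
under eq_fun => n.
  under eq_bigr do rewrite inner_conj.
  rewrite -rmorph_sum/=.
  over.
set u := fun n => \sum_(j <- initial n) inner (g j) (f j).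
have /cvgrPdist_lt ul : u n @[n --> \oo] --> limn u := @ell2_inner_cvg g f.
apply/cvgrPdist_lt => e /ul; apply: filterS => n.
by rewrite -rmorphB norm_conjC.
Qed.

Let ip_gt0 (f : ell2) : f != 0 -> 0 < ell2_inner f f.
Proof.
move=> f0.
have [j fj] : exists j, f j != 0.
  apply: contrapT => /forallNP fE; move/negP: f0; apply; apply/eqP/val_inj/funext => j.
  by apply/eqP; rewrite -[_ == _]negbK; apply/negP; exact: fE.
by rewrite (lt_le_trans _ (ell2_coord_le f j))// inner_gt0.
Qed.

Let ip_complete (u : nat -> ell2) :
  (forall e : R[i], 0 < e -> exists N, forall m n, (N <= m)%N -> (N <= n)%N ->
     ell2_inner (u m - u n) (u m - u n) < e) ->
  exists l, forall e : R[i], 0 < e -> exists N, forall n, (N <= n)%N ->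
     ell2_inner (u n - l) (u n - l) < e.
Proof.
move=> uC.
have lim_coord j : {l : H | u n j @[n --> \oo] --> l}.
  apply: cid; have [|l [ul _]] := @hilbert_complete R H (fun n => u n j).
    move=> e /uC[N HN]; exists N => m n Nm Nn.
    by apply: le_lt_trans (HN m n Nm Nn); exact: (ell2_coord_le (u m - u n)).
  by exists l.
pose g j := sval (lim_coord j).
have ug j : u n j @[n --> \oo] --> g j := svalP (lim_coord j).
have key e : 0 < e -> exists N, forall m, (N <= m)%N -> forall s, uniq s ->
    \sum_(j <- s) `|u m j - g j| ^+ 2 <= e.
  move=> e0; have [N HN] := uC _ e0; exists N => m Nm s us.
  have cv : \sum_(j <- s) `|u m j - u n j| ^+ 2 @[n --> \oo]
      --> \sum_(j <- s) `|u m j - g j| ^+ 2.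
    apply: (@cvg_sum_seq _ R[i] _ s (fun j n => `|u m j - u n j| ^+ 2)) => j.
    apply: cvg_sqr; apply: cvg_norm.
    by apply: cvgB; [exact: cvg_cst|exact: ug].
  apply: (lim_le_complex (N := N) cv).
  - by rewrite sumr_ge0// => j _; rewrite exprn_ge0.
  - exact: ltW.
  - by move=> n Nn; rewrite (le_trans (ell2_inner_ge (u m - u n) us))// ltW// HN.
have gell2 : g \in ell2_pred.
  have [N HN] := key 1 ltr01.
  have hs : (fun j => u N j - g j) \in ell2_pred.
    by apply: mem_set; exists 1 => s us; exact: HN.
  have -> : g = - 1 *: (fun j => u N j - g j) + (u N : J -> H).
    by apply/funext => j; rewrite /= !fctE scaleN1r opprB subrK.
  by have [_] := ell2_pred_closed; apply => //; exact: ell2P.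
exists (Ell2 gell2) => e e0; have e2 : 0 < e / 2 by rewrite divr_gt0.
have [N HN] := key _ e2; exists N => n Nn.
apply: (@le_lt_trans _ _ (e / 2)); last by rewrite ltr_pdivrMr// ltr_pMr// ltr1n.
by apply: ell2_inner_le => s us; exact: HN.
Qed.

HB.instance Definition _ := Lmodule_isHilbert.Build R ell2
  ip_scalar ip_conj ip_gt0 ip_complete.

End ell2_def.

Section subspaces.
Variables (R : realType) (H : hilbertType R).
Implicit Types S : set H.

Fact orth_closed S : closed_subspace [set x | forall y, S y -> inner x y = 0].
Proof.
split=> [y _|a x y xS yS z Sz|]; first by rewrite linear0l.
  by rewrite inner_scalar xS// yS// mulr0 addr0.
move=> x xS y Sy.
rewrite -(subr0 (inner x y)); apply/eqP; rewrite -normr_eq0; apply/eqP.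
apply/eqP; apply: contrapT => /negP; rewrite subr0 normr_eq0 => xy.
have /cvgrPdist_lt/(_ `|inner x y|) : inner z y @[z --> x] --> inner x y.
  exact: continuous_innerl.
rewrite normr_gt0 => /(_ xy) /xS[z [zS]] /=.
by rewrite zS// subr0 ltxx.
Qed.

Definition orth S : subspace H := Subspace (orth_closed S).

(* Applied to closed subspaces S' included in S. *)
Definition ominus S S' : set H := S `&` (orth S' : set H).

Lemma closureP S x :
  closure S x <-> forall e : R[i], 0 < e -> exists2 y, S y & `|x - y| < e.
Proof.
split=> [Sx e e0|Sx B /nbhs_normP[e /= e0 eB]].
  by have [|y [Sy]] := Sx (ball x e) _; [exact: nbhsx_ballx|rewrite -ball_normE; exists y].
by have [y Sy xy] := Sx _ e0; exists y; split => //; apply: eB.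
Qed.

Lemma closure_subspace S :
  S 0 -> (forall (a : R[i]) x y, S x -> S y -> S (a *: x + y)) ->
  closed_subspace (closure S).
Proof.
move=> S0 SD; split; [exact: subset_closure| |exact: closed_closure].
move=> a x y /closureP Sx /closureP Sy; apply/closureP => e e0.
have e2 : 0 < e / 2 by rewrite divr_gt0.
have a1 : 0 < `|a| + 1 by rewrite ltr_wpDl.
have [x' Sx' xx'] := Sx (e / 2 / (`|a| + 1)) (divr_gt0 e2 a1).
have [y' Sy' yy'] := Sy _ e2.
exists (a *: x' + y'); first exact: SD.
rewrite opprD addrACA -scalerBr (le_lt_trans (ler_normD _ _))//.
rewrite [ltRHS]splitr ler_ltD// normrZ.
rewrite (@le_trans _ _ ((`|a| + 1) * `|x - x'|))// ?ler_wpM2r// ?lerDl//.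
by rewrite mulrC -ler_pdivlMr// ltW.
Qed.

End subspaces.

(* Bounded operators: for linear maps, continuous means bounded. *)
Record bop (R : realType) (H K : hilbertType R) := BOp {
  bop_lin :> {linear H -> K};
  bop_continuous : continuous bop_lin
}.

Section operators.
Variable R : realType.

Section bop_pointed.
Variables H K : hilbertType R.

HB.instance Definition _ := gen_eqMixin (bop H K).
HB.instance Definition _ := gen_choiceMixin (bop H K).

Let zero_continuous : continuous (\0 : H -> K).
Proof. by move=> x; exact: cvg_cst. Qed.
HB.instance Definition _ :=
  isPointed.Build (bop H K) (BOp (bop_lin := \0) zero_continuous).

End bop_pointed.

Section bop.
Variables H K : hilbertType R.

Lemma bounded_continuous (A : {linear H -> K}) (M : R[i]) :
  0 <= M -> (forall x, `|A x| <= M * `|x|) -> continuous A.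
Proof.
move=> M0 AM x; apply/cvgrPdist_lt => e e0.
have M1 : 0 < M + 1 by rewrite ltr_wpDl.
near=> y.
rewrite -linearB (le_lt_trans (AM _))//.
rewrite (@le_lt_trans _ _ ((M + 1) * `|x - y|))//.
  by rewrite ler_wpM2r// lerDl.
rewrite mulrC -ltr_pdivlMr//; near: y.
apply: (@cvgr_dist_lt _ _ _ (nbhs x) _ id x); first exact: cvg_id.
by rewrite divr_gt0.
Unshelve. all: by end_near. Qed.

Definition contractive (A : bop H K) : Prop := forall x, `|A x| <= `|x|.

(* [get] picks an element of a set; here the set is a singleton by the Riesz
   representation theorem. *)
Definition adj (A : bop H K) : bop K H :=
  get [set B : bop K H | forall x y, inner (A x) y = inner x (B y)].

Definition unitary (A : bop H K) : Prop :=
  (forall x, adj A (A x) = x) /\ (forall y, A (adj A y) = y).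

Fact range_closure_closed (A : bop H K) : closed_subspace (closure (range A)).
Proof.
apply: closure_subspace; first by exists 0 => //; rewrite linear0.
by move=> a _ _ [x _ <-] [y _ <-]; exists (a *: x + y) => //; rewrite linearP.
Qed.

Definition range_closure (A : bop H K) : subspace K :=
  Subspace (range_closure_closed A).

Fact range_closureP (A : bop H K) x : A x \in in_subspace (range_closure A).
Proof. by apply: mem_set; apply: subset_closure; exists x. Qed.

(* A seen as an operator into the closure of its range. *)
Definition corange (A : bop H K) (x : H) : sub_of (range_closure A) :=
  SubOf (range_closureP A x).

End bop.

(* (I - A^* A)^(1/2), the only positive square root; used for contractive A. *)
Definition defect (H K : hilbertType R) (A : bop H K) : bop H H :=
  get [set D : bop H H | (forall x, 0 <= inner (D x) x) /\
                         (forall x, D (D x) = x - adj A (A x))].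

End operators.

(* F^2(H_n) (x) E as the space of square-summable families f : seq I -> E, where
   the letters i : I index the orthonormal basis (e_i) of H_n: the word
   w = i1 ... ik stands for the vector e_w = e_i1 (x) ... (x) e_ik of the basis of
   H_n^(x)k, and f for the sum of the orthogonal vectors e_w (x) f w.
   [fock_tensor w h] is e_w (x) h, [create i] is S_i (x) I, [vacuum] is the
   embedding h |-> 1 (x) h of E and [vacuum_proj] the projection onto its range.
   The lemmas [create_tensor], [inner_tensor2] and [fock_tensor_total] determine
   this model up to a unitary. *)
Section fock.
Variables (R : realType) (I : countType) (E : hilbertType R).
Local Notation fock := (ell2 (seq I) E).

Definition fock_tensor_fun (w : seq I) (h : E) : seq I -> E :=
  fun v => if v == w then h else 0.

Fact fock_tensor_summable w h : fock_tensor_fun w h \in @ell2_pred R (seq I) E.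
Proof.
apply: mem_set; exists (`|h| ^+ 2) => s us; rewrite /fock_tensor_fun.
case: (boolP (w \in s)) => ws.
  rewrite (big_rem w)//= eqxx big_seq big1 ?addr0// => v.
  by rewrite mem_rem_uniq// inE => /andP[/negbTE -> _]; rewrite normr0 expr0n.
rewrite big_seq big1 ?exprn_ge0// => v vs.
by rewrite (_ : v == w = false) ?normr0 ?expr0n//; apply: contraNF ws => /eqP <-.
Qed.

Definition fock_tensor w h : fock := Ell2 (fock_tensor_summable w h).

Definition create_fun (i : I) (f : fock) : seq I -> E :=
  fun w => if w is j :: v then if j == i then f v else 0 else 0.

Let strip (i : I) (w : seq I) : option (seq I) :=
  if w is j :: v then if j == i then Some v else None else None.

Let create_fun_sum i (f : fock) s :
  \sum_(w <- s) `|create_fun i f w| ^+ 2 = \sum_(v <- pmap (strip i) s) `|f v| ^+ 2.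
Proof.
elim: s => [|[|j v] s IH] /=; rewrite ?big_nil// big_cons IH/=.
  by rewrite normr0 expr0n add0r.
case: ifP => _ /=; first by rewrite big_cons.
by rewrite normr0 expr0n add0r.
Qed.

Let strip_uniq i s : uniq s -> uniq (pmap (strip i) s).
Proof.
by apply: (@pmap_uniq _ _ (strip i) (cons i)) => -[|j v] //=; case: eqP => // ->.
Qed.

Let create_fun_le i (f : fock) s : uniq s ->
  \sum_(w <- s) `|create_fun i f w| ^+ 2 <= inner f f.
Proof. by move=> us; rewrite create_fun_sum; apply/ell2_inner_ge/strip_uniq. Qed.

Fact create_summable i f : create_fun i f \in @ell2_pred R (seq I) E.
Proof. by apply: mem_set; exists (inner f f) => s; exact: create_fun_le. Qed.

Definition create_map (i : I) (f : fock) : fock := Ell2 (create_summable i f).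

Let create_linear i : linear (create_map i).
Proof.
move=> a f g; apply/val_inj/funext => -[|j v] /=.
  by rewrite !fctE/= scaler0 addr0.
by rewrite !fctE/=; case: ifP => // _; rewrite scaler0 addr0.
Qed.
HB.instance Definition _ i :=
  GRing.isLinear.Build R[i] fock fock *:%R (create_map i) (create_linear i).

Let create_le i f : `|create_map i f| <= 1 * `|f|.
Proof.
rewrite mul1r -(@ler_pXn2r _ 2) ?nnegrE// -!inner_norm.
by apply: ell2_inner_le => s; exact: create_fun_le.
Qed.

Definition create (i : I) : bop fock fock :=
  BOp (bounded_continuous ler01 (create_le i)).

Lemma create_tensor i w h : create i (fock_tensor w h) = fock_tensor (i :: w) h.
Proof.
apply/val_inj/funext => -[|j v] //=; rewrite /fock_tensor_fun.
by rewrite eqseq_cons; case: (j == i).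
Qed.

Lemma inner_tensor f w h : inner f (fock_tensor w h) = inner (f w) h.
Proof.
apply: cvg_lim => //; apply: (cvg_near_cst); exists (pickle w).+1 => // n /= wn.
have wi : w \in initial (seq I) n by rewrite mem_initial.
rewrite (big_rem w)//= /fock_tensor_fun eqxx big_seq big1 ?addr0// => v.
rewrite mem_rem_uniq ?initial_uniq// inE => /andP[/negbTE -> _].
by rewrite linear0r.
Qed.

Lemma inner_tensor2 w w' h h' :
  inner (fock_tensor w h) (fock_tensor w' h') = if w' == w then inner h h' else 0.
Proof.
rewrite inner_tensor /= /fock_tensor_fun; case: ifP => // _.
by rewrite linear0l.
Qed.

Lemma fock_tensor_total f : (forall w h, inner f (fock_tensor w h) = 0) -> f = 0.
Proof.
move=> f0; apply/val_inj/funext => w; apply/eqP; rewrite -normr_eq0 -sqrf_eq0.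
by rewrite -inner_norm -inner_tensor f0.
Qed.

Definition vacuum (h : E) : fock := fock_tensor [::] h.

Definition vacuum_proj (f : fock) : fock := vacuum (f [::]).

Lemma vacuum_projP f h : inner (f - vacuum_proj f) (vacuum h) = 0.
Proof. by rewrite inner_tensor /= !fctE /= /fock_tensor_fun subrr linear0l. Qed.

End fock.


(* n = None stands for n = infinity. *)
Definition letter (n : option nat) : countType :=
  if n is Some m then 'I_m : countType else nat.

Definition fock (R : realType) (n : option nat) (E : hilbertType R) :
  hilbertType R := ell2 (seq (letter n)) E.

Definition multi_analytic (R : realType) (n : option nat)
    (E F : hilbertType R) (A : bop (fock n E) (fock n F)) : Prop :=
  forall (i : letter n) f, A (create E i f) = create F i (A f).

Definition purely_contractive (R : realType) (n : option nat)
    (E F : hilbertType R) (A : bop (fock n E) (fock n F)) : Prop :=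
  forall h : E, h != 0 -> `|vacuum_proj (A (vacuum (letter n) h))| < `|h|.

Definition defect_space (R : realType) (H K : hilbertType R) (A : bop H K) :
  hilbertType R := sub_of (range_closure (defect A)).

Definition defect_map (R : realType) (H K : hilbertType R) (A : bop H K) :
  H -> defect_space A := corange (defect A).

Section model.
Variables (R : realType) (n : option nat) (E Es : hilbertType R).
Variable Theta : bop (fock n E) (fock n Es).

(* C_i; it is isometric on the range of the defect operator, which is dense, so
   it extends uniquely. *)
Definition defect_create (i : letter n) :
    bop (defect_space Theta) (defect_space Theta) :=
  get [set C : bop (defect_space Theta) (defect_space Theta) |
    forall g, C (defect_map Theta g) = defect_map Theta (create E i g)].

(* The direct sum of F^2(H_n) (x) E_* and the closure of the range of Delta. *)
Definition ambient : hilbertType R := hsum (fock n Es) (defect_space Theta).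

Definition graph : set ambient :=
  [set HSum (Theta g) (defect_map Theta g) | g in setT].

Definition model_space : subspace ambient := orth graph.

(* T_i, given through its adjoint; adj (create Es i) is S_i^* (x) I. *)
Definition model_op (i : letter n) :
    bop (sub_of model_space) (sub_of model_space) :=
  get [set T : bop (sub_of model_space) (sub_of model_space) |
    forall x, incl (adj T x) =
      HSum (adj (create Es i) (hfst (incl x)))
           (adj (defect_create i) (hsnd (incl x)))].

Definition invariant_subspace (M : set ambient) : Prop :=
  [/\ closed_subspace M, M `<=` model_space &
      forall i (x : sub_of model_space), M (incl x) -> M (incl (model_op i x))].

Section factorization.
Variables (F : hilbertType R).
Variables (Theta2 : bop (fock n F) (fock n Es)).
Variables (Theta1 : bop (fock n E) (fock n F)).

(* X_Theta: when Theta = Theta2 Theta1 it is isometric on a dense subspace and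
   extends uniquely. *)
Definition factor_map : bop (defect_space Theta)
    (hsum (defect_space Theta2) (defect_space Theta1)) :=
  get [set X : bop (defect_space Theta)
                   (hsum (defect_space Theta2) (defect_space Theta1)) |
    forall f, X (defect_map Theta f) =
      HSum (defect_map Theta2 (Theta1 f)) (defect_map Theta1 f)].

Definition regular_factorization : Prop :=
  [/\ contractive Theta1 /\ multi_analytic Theta1,
      contractive Theta2 /\ multi_analytic Theta2,
      forall f, Theta f = Theta2 (Theta1 f) &
      unitary factor_map].

Definition factor_space1 : set ambient :=
  ominus [set HSum (Theta2 f)
                (adj factor_map (HSum (defect_map Theta2 f) g))
          | f in setT & g in setT]
         graph.

Definition factor_space2 : set ambient :=
  ominus [set HSum f (adj factor_map (HSum d 0)) | f in setT & d in setT]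
         [set HSum (Theta2 f) (adj factor_map (HSum (defect_map Theta2 f) 0))
          | f in setT].

End factorization.
End model.

Arguments invariant_subspace {R n E Es} Theta M.
Arguments factor_map {R n E Es} Theta {F} Theta2 Theta1.
Arguments regular_factorization {R n E Es} Theta {F} Theta2 Theta1.
Arguments factor_space1 {R n E Es} Theta {F} Theta2 Theta1.
Arguments factor_space2 {R n E Es} Theta {F} Theta2 Theta1.
Arguments vacuum {R I E} h.

(* Main.v *)
Require Import Defs.
From HB Require Import structures.
From mathcomp Require Import all_boot all_order all_algebra.
From mathcomp Require Import ring lra complex.
From mathcomp Require Import boolp classical_sets reals topology normedtype.

Set Implicit Arguments.
Unset Strict Implicit.
Unset Printing Implicit Defensive.
Import Order.TTheory GRing.Theory Num.Theory.
Import numFieldNormedType.Exports.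
Local Open Scope classical_set_scope.
Local Open Scope ring_scope.

(**
The dilation space [ambient] carries the row isometry V_i = S_i (+) C_i
([dilation]), the graph G = {Theta g (+) Delta g} is the isometric and V-invariant
image of a Fock space ([graph_embedding]), and the operators T_i are the
compressions of the V_i to the complement H of G ([model_op_inner]). A closed
subspace H1 of H is therefore invariant under the T_i exactly when H1 + G is
invariant under the V_i; one passes back by H1 = M - G and H - H1 = M^perp for
M = H1 + G ([invariant_dilation], [invariant_ominus_graph], [ominus_ominus],
[ominus_orth_ominus]). So the theorem is about the V-invariant subspaces M that
contain G.

A regular factorization Theta = Theta2 Theta1 yields such an M, namely
{Theta2 f (+) X^* (Delta2 f (+) g)} ([factor_range]): it is the range of an
isometry, hence closed, it contains the image of Theta1 g and Delta1 g, that is G,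
and it is invariant since X intertwines the operators C_i of the three defect
spaces. Its orthogonal complement is the space called H2 in the theorem
([factor_space2E]).

Conversely, let M be V-invariant and contain G. By the Wold decomposition
([wold]), M = Psi (F^2 (x) L) (+) U where L is the wandering subspace, Psi is an
isometry intertwining the S_i and the V_i, and the adjoints of the V_i preserve U.
Every vector of U has zero Fock component ([residual_hfst]). Let Theta2 be
the Fock component of Psi and let Theta1 g be the pure part, read in F^2 (x) L, of
Theta g (+) Delta g. Comparing norms shows that the remaining component of Psi f
is an isometric image of Delta2 f, and that the U-part of Theta g (+) Delta g is an
isometric image of Delta1 g. As Delta g is the sum of these two orthogonal
contributions and the vectors Delta g are dense, X is unitary, and M is the
subspace attached to the factorization ([dilation_invariant_factor]).

Adjoints, the operators Delta, the C_i, the T_i and X are all specified as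
operators selected by a property; the lemmas that exhibit such an operator
([adjP], [defectP], [defect_createP], [model_opP], [factor_mapP]) are what gives
access to them.
*)

(** * Orthogonal projections *)
Section projection.
Variable R : realType.
Implicit Types H K : hilbertType R.

Lemma inv_nat_lt (e : R[i]) : 0 < e -> exists N, forall n, (N <= n)%N -> n.+1%:R^-1 < e.
Proof.
move=> e0; have eE : e = (complex.Re e)%:C%C by rewrite RRe_real// gtr0_real.
have e0' : 0 < complex.Re e by rewrite -ltcR -eE.
exists (Num.truncn (complex.Re e)^-1) => n Nn.
rewrite invf_plt ?posrE ?ltr0n//.
rewrite eE -fmorphV -(rmorph_nat (real_complex R)) ltcR.
by rewrite (lt_le_trans (truncnS_gt _))// ler_nat.
Qed.

Lemma innerDl H (x y z : H) : inner (x + y) z = inner x z + inner y z.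
Proof. by rewrite linearDl. Qed.

Lemma innerDr H (x y z : H) : inner x (y + z) = inner x y + inner x z.
Proof. by rewrite linearDr. Qed.

Lemma innerNl H (x y : H) : inner (- x) y = - inner x y.
Proof. by rewrite linearNl. Qed.

Lemma innerNr H (x y : H) : inner x (- y) = - inner x y.
Proof. by rewrite linearNr. Qed.

Lemma innerBl H (x y z : H) : inner (x - y) z = inner x z - inner y z.
Proof. by rewrite linearBl. Qed.

Lemma innerBr H (x y z : H) : inner x (y - z) = inner x y - inner x z.
Proof. by rewrite linearBr. Qed.

Lemma innerZl H a (x y : H) : inner (a *: x) y = a * inner x y.
Proof. by rewrite linearZl_LR. Qed.

Lemma innerZr H a (x y : H) : inner x (a *: y) = a^* * inner x y.
Proof. by rewrite linearZr_LR. Qed.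

Lemma inner0l H (x : H) : inner 0 x = 0.
Proof. by rewrite linear0l. Qed.

Lemma inner0r H (x : H) : inner x 0 = 0.
Proof. by rewrite linear0r. Qed.

Lemma inner_ge0 H (x : H) : 0 <= inner x x.
Proof. by rewrite inner_norm exprn_ge0. Qed.

Lemma inner_eq0 H (x : H) : inner x x = 0 -> x = 0.
Proof. by rewrite inner_norm => /eqP; rewrite sqrf_eq0 normr_eq0 => /eqP. Qed.

Lemma inner_sym0 H (x y : H) : inner x y = 0 -> inner y x = 0.
Proof. by move=> xy; rewrite inner_conj xy conjC0. Qed.

Lemma inner_ext H (x y : H) : (forall z, inner x z = inner y z) -> x = y.
Proof.
move=> xy; apply/eqP; rewrite -subr_eq0; apply/eqP/inner_eq0.
by rewrite innerBl xy subrr.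
Qed.

Lemma ler_norm_inner H K (x : H) (y : K) : (`|x| <= `|y|) = (inner x x <= inner y y).
Proof. by rewrite !inner_norm ler_pXn2r ?nnegrE. Qed.

Lemma norm_eq_inner H K (x : H) (y : K) : inner x x = inner y y -> `|x| = `|y|.
Proof. by move=> xy; apply/le_anti; rewrite !ler_norm_inner xy lexx. Qed.

Lemma closed_mem H (M : set H) x : closed M ->
  (forall e : R[i], 0 < e -> exists2 y, M y & `|x - y| < e) -> M x.
Proof. by move=> /closure_id {2}->; exact: (closureP M x).2. Qed.

Lemma parallelogram H (x y : H) :
  inner (x + y) (x + y) + inner (x - y) (x - y) = 2 * inner x x + 2 * inner y y.
Proof. by rewrite !innerDl !innerDr !innerNl !innerNr; ring. Qed.

(** Moving from [q] along [y] by the coefficient [inner q y / inner y y] lowers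
the squared norm by [`|inner q y| ^+ 2 / inner y y], so a vector of minimal
norm in [q + M] leaves no such coefficient. *)
Lemma nearest_orth H (M : set H) (q : H) : closed_subspace M ->
  (forall z, M z -> inner q q <= inner (q - z) (q - z)) ->
  forall y, M y -> inner q y = 0.
Proof.
move=> [M0 MD _] min y My; have [->|y0] := eqVneq y 0; first exact: inner0r.
pose a := inner q y / inner y y.
have /min : M (a *: y) by rewrite -[_ *: _]addr0; exact: MD.
have yy : inner y y != 0 by rewrite gt_eqF// inner_gt0.
rewrite innerBl !innerBr !innerZl !innerZr [inner y q]inner_conj.
have -> : a^* = (inner q y)^* / inner y y.
  by rewrite /a rmorphM fmorphV/= -(inner_conj y y).
rewrite /a; set c := inner q y; set d := inner y y; set b := inner q q.
have -> : b - c^* / d * c - (c / d * c^* - c / d * (c^* / d * d)) = b - c * c^* / d.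
  by field.
rewrite lerDl oppr_ge0 pmulr_lle0 ?invr_gt0 ?inner_gt0//.
rewrite -normCK => c0; apply/eqP; rewrite -normr_eq0 -sqrf_eq0.
by rewrite eq_le c0 exprn_ge0.
Qed.

(** A minimizing sequence for the distance from [x] to [M] is Cauchy by the
parallelogram law, because the midpoint of two terms is again in [M]. *)
Lemma projection_exists H (M : set H) (x : H) : closed_subspace M ->
  exists2 p, M p & forall y, M y -> inner (x - p) y = 0.
Proof.
move=> Mcs; have [M0 MD Mc] := Mcs.
pose g y := complex.Re (inner (x - y) (x - y)).
have gE y : (g y)%:C%C = inner (x - y) (x - y).
  by rewrite RRe_real// ger0_real// inner_ge0.
have glb : has_inf [set g y | y in M].
  split; first by exists (g 0); exists 0.
  by exists 0 => _ [y _ <-]; rewrite -lecR gE inner_ge0.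
pose d := inf [set g y | y in M].
have dle y : M y -> d <= g y by move=> My; apply: ge_inf; [case: glb|exists y].
have appr n : exists y, M y /\ g y < d + n.+1%:R^-1.
  have [|_ [y My <-] yd] := @inf_adherent R _ n.+1%:R^-1 _ glb.
    by rewrite invr_gt0.
  by exists y.
have /choice[u uP] := appr.
have uM n : M (u n) by case: (uP n).
have ud n : g (u n) < d + n.+1%:R^-1 by case: (uP n).
(* Two nearly minimal points are close: their midpoint is no nearer than [d]. *)
have dist m n : inner (u m - u n) (u m - u n) <= 2 * (m.+1%:R^-1 + n.+1%:R^-1).
  have := parallelogram (x - u m) (x - u n).
  have -> : x - u m - (x - u n) = - (u m - u n).
    by rewrite opprD opprK addrACA subrr add0r opprB addrC.
  have half : M (2^-1 *: (u m + u n)).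
    rewrite -[_ *: _]addr0; apply: (MD) => //.
    by rewrite -[u m]scale1r; exact: MD.
  have -> : x - u m + (x - u n) = 2 *: (x - 2^-1 *: (u m + u n)).
    rewrite scalerBr scalerA divff ?pnatr_eq0// scale1r scaler_nat mulr2n opprD.
    by rewrite addrACA.
  have -> : inner (- (u m - u n)) (- (u m - u n)) = inner (u m - u n) (u m - u n).
    by rewrite !inner_norm normrN.
  rewrite innerZl innerZr conjC_nat -!gE.
  move: (2^-1 *: _) half => h half /(canRL (addKr _)) ->.
  have nat_inv k : (k.+1%:R^-1 : R[i]) = (k.+1%:R^-1)%:C%C.
    by rewrite fmorphV rmorph_nat.
  rewrite (nat_inv m) (nat_inv n).
  have -> : (2 : R[i]) = (2 : R)%:C%C by rewrite rmorph_nat.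
  rewrite -!rmorphM/= -rmorphN/= -!rmorphD/= -!rmorphM/= lecR.
  have := dle _ half; have := ud m; have := ud n.
  move: (m.+1%:R^-1) (n.+1%:R^-1) => a b.
  by lra.
have small (e : R[i]) : 0 < e -> exists N, forall m n, (N <= m)%N -> (N <= n)%N ->
     inner (u m - u n) (u m - u n) < e.
  move=> e0; have [|N HN] := @inv_nat_lt (e / 4); first by rewrite divr_gt0.
  exists N => m n /HN Nm /HN Nn; apply: le_lt_trans (dist m n) _.
  have -> : e = 2 * (e / 4 + e / 4) by field.
  by rewrite ltr_pM2l// ltrD.
have [p [up upe]] := hilbert_complete small.
have Mp : M p.
  apply: closed_mem => // e e0; have [N HN] := upe _ (exprn_gt0 2 e0).
  exists (u N) => //; rewrite distrC -(@ltr_pXn2r _ 2) ?nnegrE// ?ltW//.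
  by rewrite -inner_norm HN.
exists p => //; apply: nearest_orth => // z Mz.
have Mpz : M (p + z) by rewrite -[p]scale1r; exact: MD.
rewrite -addrA -opprD -!gE lecR; apply: le_trans (dle _ Mpz).
have : inner (x - p) (x - p) <= d%:C%C.
  have cv : inner (x - u n) (x - u n) @[n --> \oo] --> inner (x - p) (x - p).
    rewrite inner_norm; under eq_fun do rewrite inner_norm.
    by apply: cvg_sqr; apply: cvg_norm; apply: cvgB => //; exact: cvg_cst.
  have := cvg_Re cv => {}cv.
  rewrite -gE lecR; apply/ler_addgt0Pr => e e0.
  have e0' : 0 < e%:C%C :> R[i] by rewrite -(rmorph0 (real_complex R)) ltcR.
  have [N HN] := inv_nat_lt e0'.
  apply: (cvgr_to_le cv); exists N => // n /= Nn.
  apply: le_trans (ltW (ud n)) _; rewrite lerD2l ltW//.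
  have := HN n Nn; rewrite -ltcR; congr (_ < _).
  by rewrite fmorphV rmorph_nat.
by rewrite -gE lecR.
Qed.

Lemma orthK H (M : set H) : closed_subspace M -> orth (orth M) = M :> set H.
Proof.
move=> Mcs; apply/seteqP; split=> x.
  move=> xM; have [p Mp xp] := projection_exists x Mcs.
  suff -> : x = p by [].
  apply/eqP; rewrite -subr_eq0; apply/eqP/inner_eq0.
  by rewrite innerBl xM// (inner_sym0 (xp _ Mp)) subrr.
by move=> Mx y yM; exact/inner_sym0/yM.
Qed.

End projection.

(** * Bounded operators and adjoints *)
Section adjoint.
Variable R : realType.
Implicit Types H K : hilbertType R.

Lemma bop_bounded H K (A : bop H K) :
  exists2 M : R[i], 0 <= M & forall x, `|A x| <= M * `|x|.
Proof.
have /linear_boundedP/pinfty_ex_gt0[M M0 AM] :=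
  continuous_linear_bounded 0 (@bop_continuous R H K A 0).
by exists M => //; exact: ltW.
Qed.

Lemma bop_exists H K (f : H -> K) (M : R[i]) : linear f -> 0 <= M ->
  (forall x, `|f x| <= M * `|x|) -> exists A : bop H K, forall x, A x = f x.
Proof.
move=> flin M0 fM.
pose fL : {linear H -> K} := HB.pack f (GRing.isLinear.Build R[i] H K *:%R f flin).
by exists (BOp (bounded_continuous (A := fL) M0 fM)).
Qed.

(** Bounded operators are bundled with their linearity and continuity, so the
usual constructions are stated as the existence of an operator with the given
values. *)
Lemma comp_exists H K L (A : bop K L) (B : bop H K) :
  exists C : bop H L, forall x, C x = A (B x).
Proof.
have [M M0 AM] := bop_bounded A; have [N N0 BN] := bop_bounded B.
apply: (bop_exists (M := M * N)).
- by move=> a x y; rewrite !linearP.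
- exact: mulr_ge0.
- by move=> x; rewrite (le_trans (AM _))// -mulrA ler_wpM2l.
Qed.

Lemma id_exists H : exists A : bop H H, forall x, A x = x.
Proof. by apply: (bop_exists (M := 1)) => // x; rewrite mul1r. Qed.

(** Adjointness alone forces linearity; this spares checking it for maps that
are obtained by choice or as pointwise limits. *)
Lemma inner_lin_ext H K (f : H -> K) (g : K -> H) :
  (forall x y, inner (f x) y = inner x (g y)) -> linear f.
Proof.
move=> fg a x y; apply: inner_ext => z.
by rewrite innerDl innerZl !fg innerDl innerZl.
Qed.

(** If [phi] does not vanish, a vector [q] orthogonal to its kernel represents it
up to the scalar [phi q / inner q q], since [x - phi x / phi q *: q] lies in the
kernel for every [x]. *)
Lemma riesz H (phi : H -> R[i]) (M : R[i]) : scalar phi -> 0 <= M ->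
  (forall x, `|phi x| <= M * `|x|) -> exists y, forall x, phi x = inner x y.
Proof.
move=> lin M0 bd.
have phi0 : phi 0 = 0.
  by have := lin (-1) 0 0; rewrite scaler0 addr0 /= mulN1r addNr.
have phiN x : phi (- x) = - phi x.
  by rewrite -[- x]addr0 -scaleN1r lin phi0 addr0 /= mulN1r.
have phiD x y : phi (x + y) = phi x + phi y.
  by rewrite -[x]scale1r lin /= mul1r scale1r.
have phiZ a x : phi (a *: x) = a * phi x.
  by rewrite -[_ *: _]addr0 lin phi0 addr0.
have Ncs : closed_subspace [set x | phi x = 0].
  split=> [|a x y /= x0 y0|] //=; first by rewrite lin x0 y0 mulr0 addr0.
  move=> x /closureP xN; apply/eqP; rewrite -normr_le0.
  apply/ler_addgt0Pr => e e0.
  have M1 : 0 < M + 1 by rewrite ltr_wpDl.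
  have [y /= y0 xy] := xN (e / (M + 1)) (divr_gt0 e0 M1).
  have -> : phi x = phi (x - y) by rewrite phiD phiN y0 subr0.
  rewrite add0r (le_trans (bd _))//.
  rewrite (@le_trans _ _ ((M + 1) * `|x - y|))//.
    by rewrite ler_wpM2r// lerDl.
  by rewrite mulrC -ler_pdivlMr// ltW.
have [all0|/existsNP[x0 /eqP x00]] := pselect (forall x, phi x = 0).
  by exists 0 => x; rewrite all0 inner0r.
have [p p0 qN] := projection_exists x0 Ncs.
pose q := x0 - p.
have phiq : phi q != 0 by rewrite phiD phiN p0 subr0.
have qq : inner q q != 0.
  by apply: contra phiq => /eqP/inner_eq0 ->; rewrite phi0.
exists ((phi q / inner q q)^* *: q) => x.
rewrite innerZr conjCK.
have : inner q (x - phi x / phi q *: q) = 0.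
  by apply: qN; rewrite /= phiD phiN phiZ divfK// subrr.
move/inner_sym0; rewrite innerBl innerZl => /eqP; rewrite subr_eq0 => /eqP ->.
by field; rewrite qq phiq.
Qed.

Lemma adj_exists H K (A : bop H K) :
  exists B : bop K H, forall x y, inner (A x) y = inner x (B y).
Proof.
have [M M0 AM] := bop_bounded A.
have /choice[g gP] : forall y, exists z, forall x, inner (A x) y = inner x z.
  move=> y; apply: (@riesz _ _ (M * `|y|)).
  - by move=> a u v; rewrite linearP innerDl innerZl.
  - by rewrite mulr_ge0.
  - by move=> x; rewrite (le_trans (Defs.CauchySchwarz _ _))// mulrAC ler_wpM2r.
have gP' y x : inner (g y) x = inner y (A x).
  by rewrite inner_conj -gP -inner_conj.
have [||B BE] := @bop_exists K H g M _ M0.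
- exact: inner_lin_ext gP'.
- move=> y; have [->|gy0] := eqVneq (g y) 0; first by rewrite normr0 mulr_ge0.
  have gy : 0 < `|g y| by rewrite normr_gt0.
  rewrite -(ler_pM2r gy) -expr2 -inner_norm -gP.
  have := Defs.CauchySchwarz (A (g y)) y.
  rewrite ger0_norm; last by rewrite gP inner_ge0.
  by move/le_trans; apply; rewrite mulrAC ler_wpM2r.
by exists B => x y; rewrite BE gP.
Qed.

Lemma adjP H K (A : bop H K) x y : inner (A x) y = inner x (adj A y).
Proof. exact: (getPex (adj_exists A)). Qed.

Lemma adjPr H K (A : bop H K) x y : inner y (A x) = inner (adj A y) x.
Proof. by rewrite inner_conj adjP -inner_conj. Qed.

Lemma adj_uniq H K (A : bop H K) (B : K -> H) :
  (forall x y, inner (A x) y = inner x (B y)) -> adj A =1 B.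
Proof.
move=> AB y; apply: inner_ext => z.
by rewrite [LHS]inner_conj -adjP AB -inner_conj.
Qed.

Lemma adjK H K (A : bop H K) : adj (adj A) =1 A.
Proof. by apply: adj_uniq => x y; rewrite -adjPr. Qed.

Lemma adj_contractive H K (A : bop H K) : contractive A -> contractive (adj A).
Proof.
move=> Ac y; have [->|gy0] := eqVneq (adj A y) 0; first by rewrite normr0.
have gy : 0 < `|adj A y| by rewrite normr_gt0.
rewrite -(ler_pM2r gy) -expr2 -inner_norm -adjP.
have := Defs.CauchySchwarz (A (adj A y)) y.
rewrite ger0_norm; last by rewrite adjP inner_ge0.
by move/le_trans; apply; rewrite mulrC ler_wpM2l.
Qed.

Lemma bop_eq_dense H K (S : set H) (A B : bop H K) :
  (forall x, S x -> A x = B x) -> forall x, closure S x -> A x = B x.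
Proof.
move=> AB x Sx; apply: inner_ext => z.
apply/eqP; rewrite -subr_eq0 !adjP -innerBr; apply/eqP.
have [_ _ Nc] := orth_closed [set adj A z - adj B z].
have : closure [set y | forall w, [set adj A z - adj B z] w -> inner y w = 0] x.
  by apply: closure_subset Sx => y Sy w ->; rewrite innerBr -!adjP AB// subrr.
by move/Nc; exact.
Qed.

End adjoint.

(** * Hilbert sums *)
Section hilbert_sum.
Variable R : realType.
Implicit Types H K L : hilbertType R.

Lemma hsum_inner H K (p q : hsum H K) :
  inner p q = inner (hfst p) (hfst q) + inner (hsnd p) (hsnd q).
Proof. by []. Qed.

Lemma hsum_innerr H K (p : hsum H K) (a : H) (b : K) :
  inner p (HSum a b) = inner (hfst p) a + inner (hsnd p) b.
Proof. by []. Qed.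

Lemma hsum_innerE H K (a a' : H) (b b' : K) :
  inner (HSum a b) (HSum a' b') = inner a a' + inner b b'.
Proof. by []. Qed.

Lemma hsum_norm_hfst H K (p : hsum H K) : `|hfst p| <= `|p|.
Proof.
by rewrite ler_norm_inner hsum_inner lerDl inner_ge0.
Qed.

Lemma hsum_norm_hsnd H K (p : hsum H K) : `|hsnd p| <= `|p|.
Proof.
by rewrite ler_norm_inner hsum_inner lerDr inner_ge0.
Qed.

Lemma sum_exists H K L (A : bop H L) (B : bop K L) :
  exists Z : bop (hsum H K) L, forall p, Z p = A (hfst p) + B (hsnd p).
Proof.
have [M M0 AM] := bop_bounded A; have [N N0 BN] := bop_bounded B.
apply: (bop_exists (M := M + N)).
- by move=> a x y; rewrite !linearP /= scalerDr addrACA.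
- exact: addr_ge0.
- move=> x; rewrite (le_trans (ler_normD _ _))// mulrDl lerD//.
    by rewrite (le_trans (AM _))// ler_wpM2l// hsum_norm_hfst.
  by rewrite (le_trans (BN _))// ler_wpM2l// hsum_norm_hsnd.
Qed.

Lemma sub_exists H K (A B : bop H K) :
  exists C : bop H K, forall x, C x = A x - B x.
Proof.
have [M M0 AM] := bop_bounded A; have [N N0 BN] := bop_bounded B.
apply: (bop_exists (M := M + N)).
- by move=> a x y; rewrite (linearP A) (linearP B) scalerBr opprD addrACA.
- exact: addr_ge0.
- by move=> x; rewrite (le_trans (ler_normB _ _))// mulrDl lerD.
Qed.

Lemma hfst_exists H K :
  exists A : bop (hsum H K) H, forall x, A x = hfst x.
Proof.
by apply: (bop_exists (M := 1)) => // x; rewrite mul1r hsum_norm_hfst.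
Qed.

Lemma hsnd_exists H K :
  exists A : bop (hsum H K) K, forall x, A x = hsnd x.
Proof.
by apply: (bop_exists (M := 1)) => // x; rewrite mul1r hsum_norm_hsnd.
Qed.

Lemma hsum_ext H K (p q : hsum H K) :
  hfst p = hfst q -> hsnd p = hsnd q -> p = q.
Proof. by case: p => a b; case: q => c d /= -> ->. Qed.

Lemma hsum_bop H K H' K' (A : bop H H') (B : bop K K') :
  exists D : bop (hsum H K) (hsum H' K'),
    (forall p, D p = HSum (A (hfst p)) (B (hsnd p))) /\
    (forall p, adj D p = HSum (adj A (hfst p)) (adj B (hsnd p))).
Proof.
have [M M0 AM] := bop_bounded A; have [N N0 BN] := bop_bounded B.
have [|||D DE] := @bop_exists R (hsum H K) (hsum H' K')
    (fun p => HSum (A (hfst p)) (B (hsnd p))) (M + N).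
- by move=> a x y; rewrite /= !linearP.
- exact: addr_ge0.
- move=> p.
  have -> : HSum (A (hfst p)) (B (hsnd p)) =
      HSum (A (hfst p)) 0 + HSum 0 (B (hsnd p)).
    by rewrite -[RHS]/(HSum (A (hfst p) + 0) (0 + B (hsnd p))) addr0 add0r.
  have n1 x : `|(HSum x 0 : hsum H' K')| = `|x|.
    by apply/le_anti; rewrite !ler_norm_inner hsum_inner /= inner0l addr0 lexx.
  have n2 x : `|(HSum 0 x : hsum H' K')| = `|x|.
    by apply/le_anti; rewrite !ler_norm_inner hsum_inner /= inner0l add0r lexx.
  rewrite (le_trans (ler_normD _ _))// n1 n2 mulrDl lerD//.
    by rewrite (le_trans (AM _))// ler_wpM2l// hsum_norm_hfst.
  by rewrite (le_trans (BN _))// ler_wpM2l// hsum_norm_hsnd.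
exists D; split => //; apply: adj_uniq => x y; rewrite DE.
by rewrite !hsum_inner /= !adjP.
Qed.

End hilbert_sum.

(** * Dense ranges and isometries *)
Section density.
Variable R : realType.
Implicit Types H K L : hilbertType R.

(** The orthogonal complement of a vector is closed. *)
Lemma closure_orth H (S : set H) (w : H) :
  (forall y, S y -> inner y w = 0) -> forall x, closure S x -> inner x w = 0.
Proof.
move=> Sw x Sx.
have : closure (orth [set w]) x.
  by apply: closure_subset Sx => y Sy z ->; exact: Sw.
by have [_ _ /closure_id <-] := subspace_closed (orth [set w]); exact.
Qed.

(** Both sides are continuous in [u] and in [v], so it is enough to test them on
dense ranges. *)
Lemma inner_dense H K (X : Type) (f : X -> H) (A B : bop H K) (c : R[i]) :
  (forall x, closure (range f) x) ->
  (forall x y, inner (A (f x)) (B (f y)) = c * inner (f x) (f y)) ->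
  forall u v, inner (A u) (B v) = c * inner u v.
Proof.
move=> dense AB u v.
have E (p q : H) : inner (A p) (B q) - c * inner p q = inner p (adj A (B q) - c^* *: q).
  by rewrite innerBr innerZr conjCK adjP.
have E' (p q : H) : inner (B q) (A p) - c^* * inner q p = inner q (adj B (A p) - c *: p).
  by rewrite innerBr innerZr adjP.
apply/eqP; rewrite -subr_eq0 E; apply/eqP; apply: closure_orth (dense u).
move=> _ [x _ <-]; rewrite -E inner_conj [inner (f x) v]inner_conj.
rewrite -[c]conjCK -rmorphM -rmorphB /= E' .
rewrite (closure_orth _ (dense v)) ?conjC0//.
move=> _ [y _ <-]; rewrite -E' inner_conj AB rmorphM /= -inner_conj.
by rewrite subrr.
Qed.

Lemma orth_dense H K L (X Y : Type) (f : X -> H) (g : Y -> K)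
    (A : bop H L) (B : bop K L) :
  (forall x, closure (range f) x) -> (forall y, closure (range g) y) ->
  (forall x y, inner (A (f x)) (B (g y)) = 0) -> forall u v, inner (A u) (B v) = 0.
Proof.
move=> fd gd AB u v; rewrite adjP; apply: closure_orth (fd u) => _ [x _ <-].
rewrite -adjP; apply: inner_sym0; rewrite adjP; apply: closure_orth (gd v) => _ [y _ <-].
by rewrite -adjP; exact: inner_sym0.
Qed.

Lemma sub_inner H (M : Defs.subspace H) (u v : sub_of M) :
  inner u v = inner (incl u) (incl v).
Proof. by []. Qed.

Lemma sub_norm H (M : Defs.subspace H) (u : sub_of M) : `|u| = `|incl u|.
Proof. by apply/le_anti; rewrite !ler_norm_inner sub_inner lexx. Qed.

(** By polarization, preserving norms is the same as preserving inner products. *)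
Lemma isometryP H K (A : bop H K) : (forall x, `|A x| = `|x|) ->
  forall x, adj A (A x) = x.
Proof.
move=> An x; apply: inner_ext => z; rewrite -adjPr.
by rewrite !polarization -!linearZ -!linearD -!linearB !An.
Qed.

Lemma inner_isometry_adj H K (A : bop H K) :
  (forall x y, inner (A x) (A y) = inner x y) -> forall x, adj A (A x) = x.
Proof. by move=> AA x; apply: inner_ext => y; rewrite -adjPr AA. Qed.

(** An isometry with a right inverse [X] is onto, hence unitary, and [X] is its
adjoint. *)
Lemma isometry_left_inverse H K (X : bop H K) (Z : bop K H) :
  (forall p q, inner (Z p) (Z q) = inner p q) -> (forall u, Z (X u) = u) ->
  unitary X /\ adj X =1 Z.
Proof.
move=> ZZ ZX.
have aX : adj X =1 Z.
  by apply: adj_uniq => u q; rewrite -[in RHS](ZX u) ZZ.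
split=> //; split=> [u|p]; first by rewrite aX ZX.
have aZ := inner_isometry_adj ZZ.
by rewrite aX -[LHS]aZ ZX aZ.
Qed.

(** The range of an isometry [A] is the set of fixed points of the continuous
map [A \o adj A]. *)
Lemma isometry_range_closed H K (A : bop H K) : (forall x, adj A (A x) = x) ->
  closed_subspace (range A).
Proof.
move=> AA; split; first by exists 0 => //; rewrite linear0.
  by move=> a _ _ [x _ <-] [y _ <-]; exists (a *: x + y) => //; rewrite linearP.
have [P PE] := comp_exists A (adj A).
have [I IE] := id_exists K.
move=> x Ax; exists (adj A x) => //; rewrite -PE -[RHS]IE.
by apply: bop_eq_dense Ax => _ [y _ <-]; rewrite PE IE AA.
Qed.

(** The closure of [{(f x, g x)}] in the Hilbert sum consists of pairs of equal
norm, so it is the graph of an isometry; completeness of [K] makes this graph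
defined on the whole closure of the range of [f]. *)
Lemma isometry_extend (X : lmodType R[i]) H K (f : X -> H) (g : X -> K) :
  linear f -> linear g -> (forall x, `|g x| = `|f x|) ->
  (forall h, closure (range f) h) ->
  exists C : bop H K, (forall x, C (f x) = g x) /\ (forall h, `|C h| = `|h|).
Proof.
move=> flin glin gf dense.
pose G : set (hsum H K) := [set HSum (f x) (g x) | x in setT].
have f0 : f 0 = 0.
  by have := flin (-1) 0 0; rewrite scaler0 addr0 /= scaleN1r addNr.
have g0 : g 0 = 0.
  by have := glin (-1) 0 0; rewrite scaler0 addr0 /= scaleN1r addNr.
have [G0 GD Gc] : closed_subspace (closure G).
  apply: closure_subspace; first by exists 0; rewrite // f0 g0.
  move=> a _ _ [x _ <-] [y _ <-]; exists (a *: x + y) => //.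
  by rewrite flin glin.
have Gnorm p : closure G p -> `|hsnd p| = `|hfst p|.
  move=> /closureP Gp; apply/le_anti/andP.
  split; apply/ler_addgt0Pr => e e0;
    have [_ [x _ <-] px] := Gp (e / 2) (divr_gt0 e0 (ltr0Sn _ 1));
    have h1 := le_lt_trans (hsum_norm_hfst _) px;
    have h2 := le_lt_trans (hsum_norm_hsnd _) px;
    rewrite /= in h1 h2.
  - have := ler_normD (f x - hfst p) (hfst p); rewrite subrK distrC -gf => h3.
    rewrite -[hsnd p](subrK (g x)) (le_trans (ler_normD _ _))//.
    rewrite (le_trans (lerD (ltW h2) h3))// addrA [leRHS]addrC lerD2r.
    by rewrite [leRHS]splitr lerD2l ltW.
  - have := ler_normD (g x - hsnd p) (hsnd p); rewrite subrK distrC gf => h3.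
    rewrite -[hfst p](subrK (f x)) (le_trans (ler_normD _ _))//.
    rewrite (le_trans (lerD (ltW h1) h3))// addrA [leRHS]addrC lerD2r.
    by rewrite [leRHS]splitr lerD2l ltW.
have Gex h : exists k, closure G (HSum h k).
  have /choice[u uP] n : exists x, `|h - f x| < n.+1%:R^-1.
    have [|_ [x _ <-] hx] := (closureP _ _).1 (dense h) n.+1%:R^-1.
      by rewrite invr_gt0.
    by exists x.
  have [|k [_ kP]] := @hilbert_complete R K (fun n => g (u n)).
    move=> e e0.
    have e2 : 0 < sqrtC e / 2 by rewrite divr_gt0// sqrtC_gt0.
    have [N HN] := inv_nat_lt e2; exists N => m n Nm Nn.
    rewrite inner_lt//.
    have -> : g (u m) - g (u n) = g (u m - u n).
      by rewrite [in RHS]addrC -scaleN1r glin scaleN1r addrC.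
    have -> : `|g (u m - u n)| = `|f (u m) - f (u n)|.
      by rewrite gf [in LHS]addrC -scaleN1r flin scaleN1r addrC.
    rewrite -[f (u m)](subrK h) -addrA (le_lt_trans (ler_normD _ _))//.
    rewrite [ltRHS]splitr distrC ltrD//.
      exact: lt_trans (uP m) (HN _ Nm).
    exact: lt_trans (uP n) (HN _ Nn).
  exists k; apply/closureP => e e0.
  have e2 : 0 < e ^+ 2 / 2 by rewrite divr_gt0// exprn_gt0.
  have [N1 HN1] := kP _ e2.
  have [N2 HN2] : exists N, forall n, (N <= n)%N ->
      inner (h - f (u n)) (h - f (u n)) < e ^+ 2 / 2.
    have s0 : 0 < sqrtC (e ^+ 2 / 2) by rewrite sqrtC_gt0.
    have [N HN] := inv_nat_lt s0; exists N => n Nn; rewrite inner_lt//.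
    exact: lt_trans (uP n) (HN _ Nn).
  pose n := maxn N1 N2.
  exists (HSum (f (u n)) (g (u n))); first by exists (u n).
  rewrite -(@ltr_pXn2r _ 2) ?nnegrE// ?ltW// -inner_norm hsum_inner [ltRHS]splitr.
  rewrite ltrD ?HN2 ?leq_maxr//.
  rewrite inner_norm distrC -inner_norm HN1 ?leq_maxl//.
have /choice[c cP] := Gex.
have Guniq h k k' : closure G (HSum h k) -> closure G (HSum h k') -> k = k'.
  move=> hk hk'.
  have := GD (-1) _ _ hk' hk => /Gnorm /=.
  rewrite !scaleN1r addNr normr0 => /normr0_eq0 /eqP.
  by rewrite addrC subr_eq0 => /eqP.
have [||C CE] := @bop_exists R H K c 1 _ ler01.
- move=> a x y; apply: (Guniq (a *: x + y)) => //.
  exact: (GD a _ _ (cP x) (cP y)).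
- by move=> x; rewrite mul1r (Gnorm _ (cP x)).
exists C; split=> [x|h]; rewrite CE; last exact: (Gnorm _ (cP h)).
by apply: (Guniq (f x)) => //; apply: subset_closure; exists x.
Qed.

Lemma isometry_extend_inner H K L (B : bop H K) (f : H -> L) :
  linear f -> (forall x, closure (range f) x) ->
  (forall x y, inner (f x) (f y) = inner (B x) (B y)) ->
  exists W : bop L K, (forall x, W (f x) = B x) /\
    (forall x y, inner (W x) (W y) = inner x y).
Proof.
move=> fl fd ff.
have [|W [WP Wn]] := isometry_extend fl (linearP B) _ fd.
  by move=> x; apply: norm_eq_inner; rewrite ff.
exists W; split=> // x y; rewrite adjP isometryP//.
Qed.

End density.

(** * Square roots of positive operators *)
Section square_root.
Variable R : realType.
Implicit Types H K : hilbertType R.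

Lemma small_eq0 (b : nat -> R[i]) (c d : R[i]) :
  (forall e, 0 < e -> exists n, b n < e) -> 0 <= c -> 0 <= d ->
  (forall n, c <= b n * d) -> c = 0.
Proof.
move=> b0 c0 d0 cb; apply/le_anti/andP; split=> //.
apply/ler_addgt0Pr => e e0; rewrite add0r.
have d1 : 0 < d + 1 by rewrite ltr_wpDl.
have [n bn] := b0 _ (divr_gt0 e0 d1).
apply: le_trans (cb n) _.
apply: (@le_trans _ _ (e / (d + 1) * d)); first by rewrite ler_wpM2r// ltW.
by rewrite mulrAC ler_pdivrMr// ler_wpM2l ?lerDl// ltW.
Qed.

(** A Cauchy sequence with an explicit modulus [b] converges at that rate; the
modulus is kept so that limits can be compared through inequalities. *)
Lemma rate_limit H (u : nat -> H) (b : nat -> R[i]) :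
  (forall e, 0 < e -> exists n, b n < e) ->
  (forall m n, (n <= m)%N -> `|u m - u n| <= b n) ->
  exists l, forall n, `|l - u n| <= b n.
Proof.
move=> b0 ub.
have bge n : 0 <= b n by apply: le_trans (ub n n (leqnn n)).
have [|l [ul _]] := @hilbert_complete R H u.
  move=> e e0; have [|N bN] := b0 (sqrtC e / 2); first by rewrite divr_gt0 ?sqrtC_gt0.
  exists N => m n Nm Nn; rewrite inner_lt//.
  rewrite -[u m](subrK (u N)) -addrA (le_lt_trans (ler_normD _ _))//.
  by rewrite [ltRHS]splitr ltrD// [X in X < _]distrC ?(le_lt_trans (ub _ _ Nn))//
    distrC (le_lt_trans (ub _ _ Nm)).
exists l => n.
have cv : `|u m - u n| @[m --> \oo] --> `|l - u n|.
  by apply: cvg_norm; apply: cvgB => //; exact: cvg_cst.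
by apply: (lim_le_complex (N := n) cv) => // m nm; exact: ub.
Qed.

(** The iteration [sqrt_iter] below, applied to the number [1] in place of the
operator [T]. It is nondecreasing and bounded by [1], and its increments
dominate those of the operator iteration in norm. *)
Fixpoint sqrt_rate (k : nat) : R[i] :=
  if k is k'.+1 then 2^-1 * (1 + sqrt_rate k' ^+ 2) else 0.

Let y := sqrt_rate.

Lemma sqrt_rate_bounds k : 0 <= y k <= 1.
Proof.
elim: k => [|k /andP[y0 y1]] /=; first by rewrite lexx ler01.
rewrite mulr_ge0 ?invr_ge0// ?addr_ge0 ?exprn_ge0//=.
rewrite ler_pdivrMl// mulr1 -[leRHS]/(1 + 1 : R[i]) lerD2l.
exact: exprn_ile1.
Qed.

Lemma sqrt_rateS k : y k <= y k.+1.
Proof.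
have /andP[y0 y1] := sqrt_rate_bounds k.
rewrite -subr_ge0 /=.
have -> : 2^-1 * (1 + y k ^+ 2) - y k = 2^-1 * (1 - y k) ^+ 2 by field.
by rewrite mulr_ge0 ?invr_ge0// exprn_ge0// subr_ge0.
Qed.

(** The bound [1] on [sqrt_rate] makes it convergent, so the remaining gap to the
limit is a modulus of convergence for the operator iteration. *)
Lemma sqrt_rate_gap : exists L : R[i],
  (forall k, y k <= L) /\ (forall e, 0 < e -> exists n, L - y n < e).
Proof.
have und : {homo y : m n / (m <= n)%N >-> m <= n}.
  by apply: homo_leq => //; [exact: le_trans|exact: sqrt_rateS].
have [||cv yL _] := @nondecreasing_complex R y 1 _ und.
- by move=> n; have /andP[] := sqrt_rate_bounds n.
- by move=> n; have /andP[] := sqrt_rate_bounds n.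
exists (limn y); split=> // e e0.
have /cvgrPdist_lt/(_ e e0)[N _ /(_ N (leqnn N)) /=] := cv.
by rewrite ger0_norm ?subr_ge0// => yN; exists N.
Qed.

Section iteration.
Variables (H : hilbertType R) (T : bop H H).
Hypotheses (Tc : contractive T) (Ts : forall x z, inner (T x) z = inner x (T z)).

(** A solution of [Z = (T + Z ^ 2) / 2] gives a square root [1 - Z] of [1 - T];
this is the Picard iteration for it, started at [0]. *)
Fixpoint sqrt_iter (k : nat) (x : H) : H :=
  if k is k'.+1 then 2^-1 *: (T x + sqrt_iter k' (sqrt_iter k' x)) else 0.

Let Y := sqrt_iter.

Lemma sqrt_iter_sym k x z : inner (Y k x) z = inner x (Y k z).
Proof.
elim: k x z => [|k IH] x z /=; first by rewrite inner0l inner0r.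
have c2 : (2^-1 : R[i])^* = 2^-1 by rewrite fmorphV /= conjC_nat.
by rewrite innerZl innerZr c2 innerDl innerDr Ts !IH.
Qed.

Lemma sqrt_iterB k x z : Y k (x - z) = Y k x - Y k z.
Proof.
have lin := inner_lin_ext (sqrt_iter_sym k).
by rewrite addrC -scaleN1r lin scaleN1r addrC.
Qed.

Lemma sqrt_iter_le k x : `|Y k x| <= y k * `|x|.
Proof.
elim: k x => [|k IH] x /=; first by rewrite normr0 mul0r.
have /andP[y0 y1] := sqrt_rate_bounds k.
rewrite normrZ ger0_norm ?invr_ge0// -mulrA ler_wpM2l ?invr_ge0//.
rewrite (le_trans (ler_normD _ _))// mulrDl mul1r lerD//.
by rewrite (le_trans (IH _))// expr2 -mulrA ler_wpM2l.
Qed.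

(** From [Y' ^ 2 - Y ^ 2 = Y' (Y' - Y) + (Y' - Y) Y], an identity that holds
whether or not [Y] and [Y'] commute, the increment is bounded by
[(y' + y) (y' - y) / 2 = (y' ^ 2 - y ^ 2) / 2], which is the next scalar increment. *)
Lemma sqrt_iterS_le k x : `|Y k.+1 x - Y k x| <= (y k.+1 - y k) * `|x|.
Proof.
elim: k x => [|k IH] x.
  rewrite !subr0 /= expr0n /= !addr0 normrZ ger0_norm ?invr_ge0//.
  by rewrite -mulrA ler_wpM2l ?invr_ge0// mul1r.
have /andP[y0 y1] := sqrt_rate_bounds k.
have /andP[z0 z1] := sqrt_rate_bounds k.+1.
have -> : Y k.+2 x - Y k.+1 x = 2^-1 *: (Y k.+1 (Y k.+1 x) - Y k (Y k x)).
  by rewrite -[Y k.+2 x]/(2^-1 *: (T x + Y k.+1 (Y k.+1 x))) -scalerBr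
    opprD addrACA subrr add0r.
have -> : y k.+2 - y k.+1 = 2^-1 * (y k.+1 ^+ 2 - y k ^+ 2).
  have yS j : y j.+1 = 2^-1 * (1 + y j ^+ 2) by [].
  rewrite (yS k.+1) [X in _ - X = _](yS k).
  by move: (y k.+1) (y k) => a c; ring.
rewrite normrZ ger0_norm ?invr_ge0// -mulrA ler_wpM2l ?invr_ge0//.
have -> : Y k.+1 (Y k.+1 x) - Y k (Y k x) =
    Y k.+1 (Y k.+1 x - Y k x) + (Y k.+1 (Y k x) - Y k (Y k x)).
  by rewrite sqrt_iterB addrA subrK.
have -> : (y k.+1 ^+ 2 - y k ^+ 2) * `|x| =
    y k.+1 * ((y k.+1 - y k) * `|x|) + (y k.+1 - y k) * (y k * `|x|) by ring.
rewrite (le_trans (ler_normD _ _))// lerD//.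
  by rewrite (le_trans (sqrt_iter_le _ _))// ler_wpM2l.
rewrite (le_trans (IH _))// ler_wpM2l ?subr_ge0 ?sqrt_rateS//.
exact: sqrt_iter_le.
Qed.

Lemma sqrt_iter_cauchy m n x : (n <= m)%N -> `|Y m x - Y n x| <= (y m - y n) * `|x|.
Proof.
elim: m => [|m IH].
  by rewrite leqn0 => /eqP ->; rewrite !subrr normr0 mul0r.
rewrite leq_eqVlt => /predU1P[->|]; first by rewrite !subrr normr0 mul0r.
rewrite ltnS => /IH nm.
rewrite -[Y m.+1 x](subrK (Y m x)) -addrA (le_trans (ler_normD _ _))//.
rewrite -[y m.+1](subrK (y m)) -[_ + y m - y n]addrA mulrDl lerD//.
exact: sqrt_iterS_le.
Qed.

(** The limit [Z] of the iteration is a self-adjoint contraction that solves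
[2 Z = T + Z ^ 2]; hence [1 - Z] is positive and its square is [1 - T]. *)
Lemma sqrt_exists : exists D : bop H H,
  (forall x, 0 <= inner (D x) x) /\ (forall x, D (D x) = x - T x).
Proof.
have [L [yL Ly]] := sqrt_rate_gap.
pose b n := L - y n.
have b0 n : 0 <= b n by rewrite subr_ge0.
have /choice[Z ZP] x : exists l, forall n, `|l - Y n x| <= b n * `|x|.
  apply: rate_limit => [e e0|m n nm].
    have x1 : 0 < `|x| + 1 by rewrite ltr_wpDl.
    have [n nP] := Ly _ (divr_gt0 e0 x1); exists n.
    rewrite (@le_lt_trans _ _ (b n * (`|x| + 1)))//.
      by rewrite ler_wpM2l// lerDl.
    by rewrite -ltr_pdivlMr.
  rewrite (le_trans (sqrt_iter_cauchy _ nm))// ler_wpM2r//.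
  by rewrite lerD2r.
have Zs x z : inner (Z x) z = inner x (Z z).
  apply/eqP; rewrite -subr_eq0 -normr_eq0; apply/eqP.
  apply: (@small_eq0 b _ (`|x| * `|z| *+ 2)) => //.
    by rewrite mulrn_wge0// mulr_ge0.
  move=> n.
  have -> : inner (Z x) z - inner x (Z z) =
      inner (Z x - Y n x) z - inner x (Z z - Y n z).
    by rewrite innerBl innerBr sqrt_iter_sym; ring.
  rewrite mulr2n mulrDr (le_trans (ler_normB _ _))// lerD//.
    rewrite (le_trans (Defs.CauchySchwarz _ _))// mulrA ler_wpM2r//.
  rewrite (le_trans (Defs.CauchySchwarz _ _))// mulrCA ler_wpM2l//.
have Zlin := inner_lin_ext Zs.
have ZB x z : Z (x - z) = Z x - Z z.
  by rewrite addrC -scaleN1r Zlin scaleN1r addrC.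
have Zc x : `|Z x| <= `|x|.
  apply/ler_addgt0Pr => e e0.
  have x1 : 0 < `|x| + 1 by rewrite ltr_wpDl.
  have [n nP] := Ly _ (divr_gt0 e0 x1).
  rewrite -[Z x](subrK (Y n x)) addrC (le_trans (ler_normD _ _))// lerD//.
    have /andP[_ y1] := sqrt_rate_bounds n.
    by rewrite (le_trans (sqrt_iter_le _ _))// ler_piMl.
  rewrite (le_trans (ZP _ _))// (@le_trans _ _ (b n * (`|x| + 1)))//.
    by rewrite ler_wpM2l// lerDl.
  by rewrite -ler_pdivlMr// ltW.
have ZZ x : 2 *: Z x = T x + Z (Z x).
  apply/eqP; rewrite -subr_eq0 -normr_eq0; apply/eqP.
  apply: (@small_eq0 b _ (`|x| *+ 4)) => //; first by rewrite mulrn_wge0.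
  move=> n.
  have TE : T x = 2 *: Y n.+1 x - Y n (Y n x).
    by rewrite /= scalerA divff ?pnatr_eq0// scale1r addrK.
  have -> : 2 *: Z x - (T x + Z (Z x)) =
      2 *: (Z x - Y n.+1 x) - ((Z (Z x) - Y n (Z x)) + Y n (Z x - Y n x)).
    rewrite TE sqrt_iterB scalerBr.
    move: (2 *: Z x) (2 *: Y n.+1 x) (Y n (Y n x)) (Z (Z x)) (Y n (Z x)) => p q r s t.
    rewrite [s - t + (t - r)]addrA subrK !opprD !opprK.
    by rewrite !addrA [in LHS]addrAC.
  rewrite (_ : 4 = 2 + 2)%N// mulrnDr mulrDr (le_trans (ler_normB _ _))//.
  rewrite lerD//.
    rewrite normrZ ger0_norm// -[`|x| *+ 2]mulr_natl mulrCA ler_wpM2l//.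
    rewrite (le_trans (ZP _ _))// ler_wpM2r//.
    by rewrite lerD2l lerN2 sqrt_rateS.
  rewrite mulr2n mulrDr (le_trans (ler_normD _ _))// lerD//.
    by rewrite (le_trans (ZP _ _))// ler_wpM2l.
  have /andP[y0 y1] := sqrt_rate_bounds n.
  rewrite (le_trans (sqrt_iter_le _ _))// (le_trans _ (ZP x n))//.
  by rewrite ler_piMl.
have [||D DE] := @bop_exists R H H (fun x => x - Z x) 2 _ (ler0n _ 2).
- by apply: (inner_lin_ext (g := fun x => x - Z x)) => x z /=; rewrite innerBl innerBr Zs.
- move=> x; rewrite (le_trans (ler_normB _ _))// -[2]/(1 + 1) mulrDl mul1r.
  by rewrite lerD2l.
exists D; split=> x; rewrite !DE.
  rewrite innerBl subr_ge0.
  have rZ : inner (Z x) x \is Num.real.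
    by apply/CrealP; rewrite -inner_conj Zs.
  rewrite (le_trans (real_ler_norm rZ))// (le_trans (Defs.CauchySchwarz _ _))//.
  by rewrite inner_norm expr2 ler_wpM2r.
rewrite ZB; have -> : T x = 2 *: Z x - Z (Z x) by rewrite ZZ addrK.
by rewrite scaler_nat mulr2n -[LHS]addrA -opprD addrA.
Qed.

End iteration.

(** The properties that [defect] selects an operator by are satisfiable. *)
Lemma defectP H K (A : bop H K) : contractive A ->
  (forall x, 0 <= inner (defect A x) x) /\
  (forall x, defect A (defect A x) = x - adj A (A x)).
Proof.
move=> Ac; rewrite /defect.
have [||T TE] := @bop_exists R H H (fun x => adj A (A x)) 1 _ ler01.
- by move=> a x z; rewrite !linearP.
- by move=> x; rewrite mul1r (le_trans (adj_contractive Ac _))// Ac.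
apply: (getPex (P := [set D : bop H H | (forall x, 0 <= inner (D x) x) /\
                         (forall x, D (D x) = x - adj A (A x))])).
have [||D [D0 DD]] := @sqrt_exists H T.
- by move=> x; rewrite TE (le_trans (adj_contractive Ac _))// Ac.
- by move=> x z; rewrite !TE -adjPr adjP.
by exists D; split=> // x; rewrite DD TE.
Qed.

(** Over the complex numbers the quadratic form [inner (D x) x] determines [D];
being real, it cannot distinguish [D] from its adjoint. The two equations come
from the vectors [x + z] and [x + 'i *: z]. *)
Lemma pos_sym H (D : bop H H) : (forall x, 0 <= inner (D x) x) ->
  forall x z, inner (D x) z = inner x (D z).
Proof.
move=> D0 x z.
have Dr w : inner (D w) w = inner w (D w).
  by rewrite [RHS]inner_conj; apply/esym/CrealP/ger0_real/D0.
have h1 := Dr (x + z); have h2 := Dr (x + 'i *: z).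
have DD u v : D (u + v) = D u + D v by rewrite linearD.
have DZ u v : D (u *: v) = u *: D v by rewrite linearZ.
rewrite !DD !innerDl !innerDr (Dr x) (Dr z) in h1.
rewrite !DD !DZ !innerDl !innerDr !innerZl !innerZr (Dr x) (Dr z) conjCi in h2.
set a := inner (D x) z in h1 h2 *; set a' := inner x (D z) in h1 h2 *.
set c := inner (D z) x in h1 h2; set c' := inner z (D x) in h1 h2.
move: (inner x (D x)) (inner z (D z)) h1 h2 => p q h1 h2.
have e1 : c - c' = - (a - a').
  apply/eqP; rewrite -subr_eq0; apply/eqP.
  by rewrite -(subrr (p + a' + (c' + q))) -{1}h1; ring.
have e2 : c - c' = a - a'.
  have i0 : 'i != 0 :> R[i] by exact: neq0Ci.
  apply: (mulfI i0); apply/eqP; rewrite -subr_eq0; apply/eqP.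
  move/eqP: h2; rewrite -subr_eq0 => /eqP h2; rewrite -[RHS]h2; ring.
have /eqP : (a - a') *+ 2 = 0 by rewrite mulr2n -{1}e2 e1 addNr.
by rewrite mulrn_eq0 /= subr_eq0 => /eqP.
Qed.

Lemma defect_inner H K (A : bop H K) : contractive A -> forall x z,
  inner (defect A x) (defect A z) = inner x z - inner (A x) (A z).
Proof.
move=> /defectP[D0 DD] x z.
by rewrite pos_sym// DD innerBr -adjP.
Qed.

End square_root.

(** * Row isometries and the Wold decomposition *)
Section row_isometry.
Variables (R : realType) (I : countType).
Implicit Types H K E : hilbertType R.

(** The adjoint of a creation operator removes the first letter. *)
Lemma adj_create E (i : I) (f : ell2 (seq I) E) w : adj (create E i) f w = f (i :: w).
Proof.
by apply: inner_ext => h; rewrite -inner_tensor -adjPr create_tensor inner_tensor.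
Qed.

Lemma create_inner E (i j : I) (f g : ell2 (seq I) E) :
  inner (create E i f) (create E j g) = (i == j)%:R * inner f g.
Proof.
rewrite adjP; have -> : adj (create E i) (create E j g) = (i == j)%:R *: g.
  apply/val_inj/funext => w; rewrite [LHS]adj_create /=.
  by case: eqP => _; rewrite ?scale1r ?scale0r.
by rewrite innerZr conjC_nat.
Qed.

(** The operator [Psi] sends the family [f] to the orthogonal sum of the
[J w (f w)]. It is built as the adjoint of the analysis operator
[x |-> (adj (J w) x)_w], which is bounded by Bessel's inequality; in this way no
infinite sum has to be formed in [K]. *)
Lemma orthogonal_family E K (J : seq I -> bop E K) :
  (forall v w x y, inner (J v x) (J w y) = (v == w)%:R * inner x y) ->
  exists Psi : bop (ell2 (seq I) E) K,
    (forall f, adj Psi (Psi f) = f) /\ (forall x w, adj Psi x w = adj (J w) x).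
Proof.
move=> JJ.
have aJ v w x : adj (J v) (J w x) = (v == w)%:R *: x.
  apply: inner_ext => z; rewrite -adjPr JJ innerZl eq_sym //.
have aJs (s : seq (seq I)) (a : seq I -> E) v : uniq s -> v \in s ->
    adj (J v) (\sum_(w <- s) J w (a w)) = a v.
  move=> us vs; rewrite linear_sum (big_rem v)//= aJ eqxx scale1r big_seq big1 ?addr0//.
  move=> w; rewrite mem_rem_uniq// inE => /andP[/negbTE wv _].
  by rewrite aJ eq_sym wv scale0r.
(* Bessel's inequality, from [0 <= inner (x - p) (x - p)]. *)
have bessel x s : uniq s -> \sum_(w <- s) `|adj (J w) x| ^+ 2 <= inner x x.
  move=> us; pose p := \sum_(w <- s) J w (adj (J w) x).
  set S := \sum_(w <- s) _.
  have S0 : 0 <= S by rewrite sumr_ge0// => w _; rewrite exprn_ge0.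
  have xp : inner x p = S.
    rewrite linear_sumr /=; apply: eq_bigr => w _.
    by rewrite adjPr inner_norm.
  have px : inner p x = S by rewrite inner_conj xp; apply/CrealP/ger0_real.
  have pp : inner p p = S.
    rewrite {2}/p linear_sumr /= big_seq [RHS]big_seq; apply: eq_bigr => w ws.
    by rewrite adjPr aJs// inner_norm.
  by have := inner_ge0 (x - p); rewrite innerBl !innerBr xp px pp subrr subr0 subr_ge0.
have sm x : (fun w => adj (J w) x) \in @ell2_pred R (seq I) E.
  by apply: mem_set; exists (inner x x) => s; exact: bessel.
have [||Q QE] := @bop_exists R K (ell2 (seq I) E) (fun x => Ell2 (sm x)) 1 _ ler01.
- by move=> a x y; apply/val_inj/funext => w; rewrite /= linearP.
- by move=> x; rewrite mul1r ler_norm_inner; apply: ell2_inner_le => s; exact: bessel.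
have Qw x w : Q x w = adj (J w) x by rewrite QE.
have aQt w l : adj Q (fock_tensor w l) = J w l.
  apply: inner_ext => z; rewrite -adjPr inner_conj inner_tensor Qw.
  by rewrite -inner_conj -adjP.
exists (adj Q); split=> [f|x w]; last by rewrite adjK Qw.
rewrite adjK; apply/val_inj/funext => w; apply: inner_ext => l.
rewrite /= Qw -adjPr -aQt -adjPr aQt.
have -> : Q (J w l) = fock_tensor w l.
  apply/val_inj/funext => v; rewrite [LHS]Qw aJ /= /fock_tensor_fun.
  by case: eqP => _; rewrite ?scale1r ?scale0r.
by rewrite inner_tensor.
Qed.

Definition row_isometry K (V : I -> bop K K) : Prop :=
  forall i j x y, inner (V i x) (V j y) = (i == j)%:R * inner x y.

Definition shift_images K (V : I -> bop K K) (M : set K) : set K :=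
  [set y | exists i m, M m /\ y = V i m].

Section wold.
Variables (K : hilbertType R) (V : I -> bop K K) (M : set K).
Hypotheses (VV : row_isometry V) (Mcs : closed_subspace M).
Hypothesis MV : forall i x, M x -> M (V i x).

Let VM := shift_images V M.

Let word (w : seq I) (x : K) : K := foldr (fun i y => V i y) x w.

Let wordM w x : M x -> M (word w x).
Proof. by move=> Mx; elim: w => //= i w; exact: MV. Qed.

(** Wold decomposition of the row isometry [V] on an invariant subspace [M]. The
wandering subspace [L] consists of the vectors of [M] orthogonal to every [V i m];
the copies of [L] under words in the [V i] are pairwise orthogonal, so they
assemble into an isometry [Psi] from the Fock space of [L] onto the pure part of
[M]. The kernel of [adj Psi] in [M] is the residual part: being orthogonal to
[L], its vectors lie in the closed span of the [V i m], and it is stable under the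
adjoints of the [V i]. *)
Lemma wold : exists (F : hilbertType R) (Psi : bop (ell2 (seq I) F) K),
  [/\ forall f, adj Psi (Psi f) = f,
      forall f, M (Psi f),
      forall i f, Psi (create F i f) = V i (Psi f),
      forall i m, M m -> adj Psi (V i m) = create F i (adj Psi m) &
      forall m, M m -> adj Psi m = 0 ->
        (orth (orth (shift_images V M)) : set K) m /\
        (forall i, M (adj (V i) m) /\ adj Psi (adj (V i) m) = 0)].
Proof.
(* [orth M] is included so that [L] is contained in [M]. *)
pose L := orth ((orth M : set K) `|` VM).
have LM x : (L : set K) x -> M x.
  by move=> Lx; rewrite -(orthK Mcs) => y My; apply: Lx; left.
have LV x i m : (L : set K) x -> M m -> inner x (V i m) = 0.
  by move=> Lx Mm; apply: Lx; right; exists i, m.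
have [J JE] : exists J : seq I -> bop (sub_of L) K,
    forall w l, J w l = word w (incl l).
  suff : forall w, exists A : bop (sub_of L) K, forall l, A l = word w (incl l).
    by move/choice => -[J JE]; exists J.
  elim=> [|i w [A AE]].
    apply: (@bop_exists R _ _ _ 1) => // l.
    by rewrite mul1r -sub_norm.
  by have [B BE] := comp_exists (V i) A; exists B => l; rewrite BE AE.
have Jcons i w l : J (i :: w) l = V i (J w l) by rewrite !JE.
have MJ w l : M (J w l) by rewrite JE; apply/wordM/LM/sub_incl.
have J0 l : J [::] l = incl l by rewrite JE.
have JJ v w x y : inner (J v x) (J w y) = (v == w)%:R * inner x y.
  elim: v w => [|i v IH] [|j w].
  - by rewrite !J0 mul1r.
  - by rewrite mul0r J0 Jcons LV//; exact: sub_incl.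
  - by rewrite mul0r J0 Jcons; apply/inner_sym0/LV => //; exact: sub_incl.
  - by rewrite !Jcons VV IH mulrA -natrM mulnb eqseq_cons.
have [Psi [PP Pw]] := orthogonal_family JJ.
have PVs i x : adj Psi (adj (V i) x) = adj (create _ i) (adj Psi x).
  apply/val_inj/funext => w; rewrite [LHS]Pw [RHS]adj_create Pw.
  by apply: inner_ext => l; rewrite -!adjPr Jcons.
exists (sub_of L), Psi; split=> //.
- move=> f; rewrite -(orthK Mcs) => x Mx.
  rewrite adjP; suff -> : adj Psi x = 0 by rewrite inner0r.
  apply/val_inj/funext => w; rewrite [LHS]Pw; apply: inner_ext => l.
  by rewrite inner0l -adjPr; apply: Mx.
- move=> i f; apply: inner_ext => x.
  by rewrite !adjP PVs -adjP.
- move=> i m Mm; apply/val_inj/funext => -[|j w]; rewrite [LHS]Pw /=.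
    apply: inner_ext => l; rewrite inner0l -adjPr J0.
    by apply/inner_sym0/LV => //; exact: sub_incl.
  apply: inner_ext => l; rewrite -adjPr Jcons VV eq_sym.
  case: eqP => _; last by rewrite mul0r inner0l.
  by rewrite mul1r adjPr -Pw.
- move=> m Mm Pm.
  have mV : (orth (orth VM) : set K) m.
    move=> y yVM; have [p Mp yp] := projection_exists y Mcs.
    have Lp : (L : set K) p.
      move=> z [zM|[i [m' [Mm' ->]]]]; first exact/inner_sym0/zM.
      have : inner (y - p) (V i m') = 0 by apply: yp; exact: MV.
      rewrite innerBl (yVM (V i m')); last by exists i, m'.
      by rewrite sub0r => /eqP; rewrite oppr_eq0 => /eqP.
    have Lp' : p \in in_subspace L by exact: mem_set.
    have /(congr1 (fun f : ell2 _ _ => inner (f [::]) (SubOf Lp'))) := Pm.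
    rewrite Pw inner0l -adjPr J0 /= => mp.
    have := inner_sym0 (yp _ Mm).
    by rewrite innerBr mp subr0.
  split=> // i; split; last by rewrite PVs Pm linear0.
  rewrite -(orthK Mcs) => y yM; rewrite -adjPr; apply: mV.
  move=> _ [j [m' [Mm' ->]]]; rewrite VV yM ?mulr0//.
Qed.

End wold.

End row_isometry.

(** * Orthogonal differences of subspaces *)
Section orthogonal_difference.
Variables (R : realType) (H : hilbertType R).
Implicit Types G M : set H.

Lemma orthS G M : G `<=` M -> (orth M : set H) `<=` (orth G : set H).
Proof. by move=> GM x xM y /GM; exact: xM. Qed.

Lemma ominus_closed G M : closed_subspace M -> closed_subspace (ominus M G).
Proof.
move=> [M0 MD Mc]; have [G0 GD Gc] := subspace_closed (orth G).
split; first by split.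
  by move=> a x y [Mx Gx] [My Gy]; split; [exact: MD|exact: GD].
exact: closedI.
Qed.

(** The space is the orthogonal sum of the closed span of [G], of [M - G] and of
[orth M]; removing the first two leaves the third. *)
Lemma ominus_ominus G M : closed_subspace M -> G `<=` M ->
  ominus (orth G) (ominus M G) = orth M.
Proof.
move=> Mcs GM; apply/seteqP; split=> x.
  move=> [xG xMG] m Mm.
  have [p pG mp] := projection_exists m (orth_closed (orth G : set H)).
  have Mp : M p by rewrite -(orthK Mcs); apply: orthS pG; exact: orthS.
  have Mmp : ominus M G (m - p).
    split; first by case: Mcs => _ + _; rewrite addrC -scaleN1r; apply.
    by move=> g Gg; apply: mp => y; move=> yG; exact/inner_sym0/yG.
  rewrite -[m](subrK p) innerDr xMG// add0r.
  exact/inner_sym0/pG.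
move=> xM; split; first exact: orthS GM _ xM.
by move=> y [My _]; exact: xM.
Qed.

Lemma ominus_orth_ominus G M : closed_subspace M -> M `<=` (orth G : set H) ->
  ominus (orth (ominus (orth G) M)) G = M.
Proof.
move=> Mcs MG; apply/seteqP; split=> x.
  move=> [xN xG]; have [p Mp xp] := projection_exists x Mcs.
  suff -> : x = p by [].
  apply/eqP; rewrite -subr_eq0; apply/eqP/inner_eq0.
  have Nxp : ominus (orth G) M (x - p).
    by split=> // g Gg; rewrite innerBl xG// (MG p Mp)// subrr.
  by rewrite innerBl xN// (inner_sym0 (xp _ Mp)) subrr.
move=> Mx; split; last exact: MG.
by move=> y [_ yM]; exact/inner_sym0/yM.
Qed.

End orthogonal_difference.

(** * Defect spaces of multi-analytic operators *)
Section defect_map.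
Variables (R : realType) (H K : hilbertType R) (A : bop H K).

Lemma defect_map_linear : linear (defect_map A).
Proof. by move=> a x y; apply/val_inj; rewrite /= linearP. Qed.

Lemma defect_map_dense u : closure (range (defect_map A)) u.
Proof.
apply/closureP => e e0.
have [_ [x _ <-] ux] := (closureP _ _).1 (sub_incl u) e e0.
by exists (defect_map A x); [exists x|rewrite sub_norm].
Qed.

Lemma defect_map_orth w : (forall x, inner (defect_map A x) w = 0) ->
  forall u, inner u w = 0.
Proof.
move=> Aw u; apply: (closure_orth _ (@defect_map_dense u)).
by move=> _ [x _ <-]; exact: Aw.
Qed.

(** The map [(A, defect_map A)] is isometric. *)
Lemma defect_map_inner : contractive A -> forall x z,
  inner (defect_map A x) (defect_map A z) = inner x z - inner (A x) (A z).
Proof. by move=> Ac x z; rewrite sub_inner /= defect_inner. Qed.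

End defect_map.

Section defect_create.
Variables (R : realType) (n : option nat) (E F : hilbertType R).
Variable A : bop (fock n E) (fock n F).
Hypotheses (Ac : contractive A) (Am : multi_analytic A).

(** The rule defining [defect_create] is isometric because [A] intertwines the
creation operators, which are isometries. *)
Lemma defect_createP i g :
  defect_create A i (defect_map A g) = defect_map A (create E i g).
Proof.
move: g; apply: (getPex (P := [set C : bop (defect_space A) (defect_space A) |
    forall g, C (defect_map A g) = defect_map A (create E i g)])).
have [||||C [CP _]] := @isometry_extend R _ _ _ (defect_map A)
    (fun g => defect_map A (create E i g)).
- exact: defect_map_linear.
- by move=> a x y; rewrite linearP defect_map_linear.
- move=> g; apply: norm_eq_inner; rewrite !defect_map_inner// Am.
  by rewrite !create_inner eqxx !mul1r.
- exact: defect_map_dense.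
by exists C.
Qed.

Lemma defect_create_row : row_isometry (defect_create A).
Proof.
move=> i j; apply: (inner_dense (f := defect_map A)); first exact: defect_map_dense.
by move=> x y; rewrite !defect_createP !defect_map_inner// !Am !create_inner mulrBr.
Qed.

End defect_create.

(** * The functional model and its row isometry *)

HB.lock Definition dsum (R : realType) (H K H' K' : hilbertType R)
    (A : bop H H') (B : bop K K') : bop (hsum H K) (hsum H' K') :=
  sval (cid (hsum_bop A B)).

Section dsum.
Variables (R : realType) (H K H' K' : hilbertType R) (A : bop H H') (B : bop K K').

Lemma dsumE p : dsum A B p = HSum (A (hfst p)) (B (hsnd p)).
Proof. by rewrite dsum.unlock; case: cid => D /= [->]. Qed.

Lemma adj_dsumE p : adj (dsum A B) p = HSum (adj A (hfst p)) (adj B (hsnd p)).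
Proof. by rewrite dsum.unlock; case: cid => D /= [_ ->]. Qed.

End dsum.

Section model.
Variables (R : realType) (n : option nat) (E Es : hilbertType R).
Variable Theta : bop (fock n E) (fock n Es).
Hypotheses (Tc : contractive Theta) (Tm : multi_analytic Theta).

(** The row isometry whose compression to the model space is [model_op]. *)
Definition dilation (i : letter n) : bop (ambient Theta) (ambient Theta) :=
  dsum (create Es i) (defect_create Theta i).

Lemma dilationE i p :
  dilation i p = HSum (create Es i (hfst p)) (defect_create Theta i (hsnd p)).
Proof. exact: dsumE. Qed.

Lemma adj_dilationE i p : adj (dilation i) p =
  HSum (adj (create Es i) (hfst p)) (adj (defect_create Theta i) (hsnd p)).
Proof. exact: adj_dsumE. Qed.

Lemma hfst_dilation i p : hfst (dilation i p) = create Es i (hfst p).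
Proof. by rewrite dilationE. Qed.

Lemma hsnd_dilation i p : hsnd (dilation i p) = defect_create Theta i (hsnd p).
Proof. by rewrite dilationE. Qed.

Lemma dilation_row : row_isometry dilation.
Proof.
move=> i j x y; rewrite [LHS]hsum_inner [inner x y]hsum_inner.
rewrite !hfst_dilation !hsnd_dilation.
by rewrite create_inner defect_create_row// mulrDr.
Qed.

(** [graph] is the range of an isometry that intertwines the creation operators
with the dilation; in particular it is invariant under the dilation, and the
model space under its adjoints. *)
Lemma graph_embedding : exists iota : bop (fock n E) (ambient Theta),
  [/\ forall g, iota g = HSum (Theta g) (defect_map Theta g),
      forall g h, inner (iota g) (iota h) = inner g h &
      forall i g, dilation i (iota g) = iota (create E i g)].
Proof.
have ii g h : inner (HSum (Theta g) (defect_map Theta g))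
    (HSum (Theta h) (defect_map Theta h)) = inner g h.
  by rewrite hsum_innerE defect_map_inner// addrC subrK.
have [||iota iotaE] := @bop_exists R (fock n E) (ambient Theta)
    (fun g => HSum (Theta g) (defect_map Theta g)) 1 _ ler01.
- by move=> a x y; rewrite linearP defect_map_linear.
- by move=> x; rewrite mul1r ler_norm_inner ii.
exists iota; split=> // [g h|i g]; first by rewrite !iotaE.
by rewrite iotaE dilationE [RHS]iotaE Tm -defect_createP.
Qed.

Lemma model_space_adj i x :
  (model_space Theta : set _) x -> (model_space Theta : set _) (adj (dilation i) x).
Proof.
have [iota [iE _ iV]] := graph_embedding.
move=> xG _ [g _ <-]; rewrite -iE -adjPr iV iE; apply: xG.
by exists (create E i g).
Qed.

Lemma model_opP i (x : sub_of (model_space Theta)) :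
  incl (adj (model_op Theta i) x) = adj (dilation i) (incl x).
Proof.
rewrite adj_dilationE; move: x.
apply: (getPex (P := [set T :
    bop (sub_of (model_space Theta)) (sub_of (model_space Theta)) |
    forall x, incl (adj T x) =
      HSum (adj (create Es i) (hfst (incl x)))
           (adj (defect_create Theta i) (hsnd (incl x)))])).
have mem (x : sub_of (model_space Theta)) :
    adj (dilation i) (incl x) \in in_subspace (model_space Theta).
  by apply: mem_set; apply: model_space_adj; exact: (sub_incl x).
have [N N0 VN] := bop_bounded (adj (dilation i)).
have [||T TE] := @bop_exists R (sub_of (model_space Theta)) (sub_of (model_space Theta))
   (fun x => SubOf (mem x)) N _ N0.
- by move=> a x y; apply/val_inj; rewrite /= linearP.
- by move=> x; rewrite !sub_norm /= VN.
by exists (adj T) => x; rewrite adjK TE /= adj_dilationE.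
Qed.

(** [model_op] is the compression of the dilation to the model space. *)
Lemma model_op_inner i (x y : sub_of (model_space Theta)) :
  inner (incl (model_op Theta i x)) (incl y) = inner (dilation i (incl x)) (incl y).
Proof. by rewrite -sub_inner [LHS]adjP [LHS]sub_inner model_opP -adjP. Qed.

(** The compression of the dilation sends [x] to the projection of
[dilation i x] along the closed span of [graph], which is contained in [M]. *)
Lemma invariant_ominus_graph (M : set (ambient Theta)) : closed_subspace M ->
  graph (Theta := Theta) `<=` M -> (forall i x, M x -> M (dilation i x)) ->
  invariant_subspace Theta (ominus M (graph (Theta := Theta))).
Proof.
move=> Mcs GM VM; split; [exact: ominus_closed|by move=> x []|].
move=> i x [Mx _]; split; last exact: sub_incl.
rewrite -(orthK Mcs) => y yM.
have ym : y \in in_subspace (model_space Theta) by apply: mem_set; exact: orthS yM.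
rewrite (model_op_inner i x (SubOf ym)); exact: inner_sym0 (yM _ (VM i _ Mx)).
Qed.

(** [orth (ominus (model_space Theta) H1)] is the sum of [H1] and the closed span
of [graph]. Its invariance is equivalent to that of the orthogonal complement of
[H1] in the model space under the adjoints of the dilation. *)
Lemma invariant_dilation H1 : invariant_subspace Theta H1 ->
  forall i x, (orth (ominus (model_space Theta) H1) : set _) x ->
    (orth (ominus (model_space Theta) H1) : set _) (dilation i x).
Proof.
move=> [H1cs H1m H1T] i x xN y [ym yH1]; rewrite adjP; apply: xN.
split; first exact: model_space_adj.
move=> z H1z; have zm := mem_set (H1m _ H1z); have ym' := mem_set ym.
rewrite -adjPr; apply: inner_sym0.
rewrite -(model_op_inner i (SubOf zm) (SubOf ym')).
by apply/inner_sym0/yH1/H1T.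
Qed.

End model.

(** * The subspace attached to a factorization *)
Section factor.
Variables (R : realType) (n : option nat) (E Es F : hilbertType R).
Variable Theta : bop (fock n E) (fock n Es).
Variables (Theta2 : bop (fock n F) (fock n Es)) (Theta1 : bop (fock n E) (fock n F)).
Hypotheses (Tc : contractive Theta) (Tm : multi_analytic Theta).
Hypotheses (T1c : contractive Theta1) (T2c : contractive Theta2).
Hypothesis fact : forall f, Theta f = Theta2 (Theta1 f).

Let X := factor_map Theta Theta2 Theta1.

(** The rule defining [factor_map] is isometric: the norms
[`|Theta1 f| ^+ 2 - `|Theta f| ^+ 2] and [`|f| ^+ 2 - `|Theta1 f| ^+ 2] of the two
components add up to that of [defect_map Theta f]. *)
Lemma factor_mapP f : X (defect_map Theta f) =
  HSum (defect_map Theta2 (Theta1 f)) (defect_map Theta1 f).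
Proof.
move: f; apply: (getPex (P := [set X : bop (defect_space Theta)
      (hsum (defect_space Theta2) (defect_space Theta1)) |
    forall f, X (defect_map Theta f) =
      HSum (defect_map Theta2 (Theta1 f)) (defect_map Theta1 f)])).
have [||||C [CP _]] := @isometry_extend R _ _
   (hsum (defect_space Theta2) (defect_space Theta1)) (defect_map Theta)
   (fun f => HSum (defect_map Theta2 (Theta1 f)) (defect_map Theta1 f)).
- exact: defect_map_linear.
- by move=> a x y; rewrite linearP !defect_map_linear.
- move=> g; apply: norm_eq_inner; rewrite hsum_innerE !defect_map_inner// fact.
  by rewrite addrC addrA subrK.
- exact: defect_map_dense.
by exists C.
Qed.

(** The invariant subspace of the dilation space that corresponds to the
factorization: [factor_space1] is by definition its difference with [graph]. *)
Definition factor_range : set (ambient Theta) :=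
  [set HSum (Theta2 f) (adj X (HSum (defect_map Theta2 f) g)) | f in setT & g in setT].

Hypotheses (T1m : multi_analytic Theta1) (T2m : multi_analytic Theta2).
Hypothesis Xu : unitary X.

Let XK u : adj X (X u) = u. Proof. by case: Xu. Qed.
Let XVK p : X (adj X p) = p. Proof. by case: Xu. Qed.
Let aX_inner p q : inner (adj X p) (adj X q) = inner p q.
Proof. by rewrite -adjPr XVK. Qed.

(** [factor_range] is the range of the isometry
[(f, g) |-> Theta2 f (+) X^* (Delta2 f (+) g)], defined on the sum of the Fock
space of [F] and the defect space of [Theta1]. *)
Lemma factor_range_closed : closed_subspace factor_range.
Proof.
pose j (p : hsum (fock n F) (defect_space Theta1)) : ambient Theta :=
  HSum (Theta2 (hfst p)) (adj X (HSum (defect_map Theta2 (hfst p)) (hsnd p))).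
have jj p q : inner (j p) (j q) = inner p q.
  rewrite [LHS]hsum_innerE [RHS]hsum_inner aX_inner hsum_innerE defect_map_inner//.
  by rewrite addrA [inner (Theta2 _) _ + _]addrC subrK.
have [||J JE] := @bop_exists R _ _ j 1 _ ler01.
- move=> a x y; rewrite /j; set z := a *: x + y.
  have -> : HSum (defect_map Theta2 (hfst z)) (hsnd z) =
      a *: HSum (defect_map Theta2 (hfst x)) (hsnd x) +
      HSum (defect_map Theta2 (hfst y)) (hsnd y).
    by rewrite -[hfst z]/(a *: hfst x + hfst y) defect_map_linear.
  by rewrite -[hfst z]/(a *: hfst x + hfst y) (linearP Theta2) (linearP (adj X)).
- by move=> p; rewrite mul1r ler_norm_inner jj.
suff -> : factor_range = range J.
  apply/isometry_range_closed/inner_isometry_adj => p q.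
  by rewrite (JE p) (JE q) jj.
apply/seteqP; split=> [_ [f _ [g _ <-]]|_ [p _ <-]].
  by exists (HSum f g) => //; rewrite JE.
by exists (hfst p) => //; exists (hsnd p) => //; rewrite JE.
Qed.

Lemma graph_factor_range : graph (Theta := Theta) `<=` factor_range.
Proof.
move=> _ [g _ <-]; exists (Theta1 g) => //; exists (defect_map Theta1 g) => //.
by rewrite -factor_mapP XK fact.
Qed.

(** [X] intertwines the isometries [defect_create] of [Theta] with those of
[Theta2] and [Theta1]: both sides agree on the dense range of [defect_map Theta]. *)
Lemma factor_map_create i u : X (defect_create Theta i u) =
  HSum (defect_create Theta2 i (hfst (X u))) (defect_create Theta1 i (hsnd (X u))).
Proof.
have [D [DE _]] := hsum_bop (defect_create Theta2 i) (defect_create Theta1 i).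
have [A AE] := comp_exists X (defect_create Theta i).
have [B BE] := comp_exists D X.
rewrite -DE -AE -BE; apply: (bop_eq_dense (S := range (defect_map Theta))).
  move=> _ [g _ <-]; rewrite AE BE DE defect_createP// !factor_mapP /=.
  by rewrite !defect_createP// T1m.
exact: defect_map_dense.
Qed.

Lemma factor_range_dilation i x : factor_range x -> factor_range (dilation Theta i x).
Proof.
move=> [f _ [g _ <-]]; exists (create F i f) => //.
exists (defect_create Theta1 i g) => //.
rewrite dilationE T2m; congr HSum.
by rewrite -[RHS]XK factor_map_create XVK /= defect_createP.
Qed.

(** For [x = a (+) u], orthogonality to [0 (+) X^* (0 (+) g)] for all [g] says
that the second component of [X u] vanishes, i.e. that [x] belongs to the larger
space in [factor_space2]. *)
Lemma factor_space2E : factor_space2 Theta Theta2 Theta1 = orth factor_range.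
Proof.
apply/seteqP; split=> [x|x xM].
  move=> [[a _ [d _ <-]] xo] _ [f _ [g _ <-]].
  have := xo _ (ex_intro2 _ _ f I erefl).
  rewrite hsum_innerE aX_inner hsum_innerE inner0r addr0 => xo'.
  rewrite hsum_innerE aX_inner hsum_innerE inner0l.
  by rewrite addr0.
split; last first.
  move=> _ [f _ <-]; apply: xM; exists f => //; exists 0 => //.
exists (hfst x) => //; exists (hfst (X (hsnd x))) => //.
have X2 : hsnd (X (hsnd x)) = 0.
  apply: inner_ext => g; rewrite inner0l.
  have := xM _ (ex_intro2 _ _ 0 I (ex_intro2 _ _ g I erefl)).
  rewrite hsum_innerr linear0 inner0r add0r -adjP hsum_innerr.
  have -> : defect_map Theta2 0 = 0 by apply/val_inj; rewrite /= linear0.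
  by rewrite inner0r add0r.
have -> : HSum (hfst (X (hsnd x))) 0 = X (hsnd x) by rewrite -X2; case: (X _).
by rewrite XK; case: (x).
Qed.

End factor.

Arguments factor_range {R n E Es F} Theta Theta2 Theta1.

(** * The factorization attached to an invariant subspace *)
Section forward.
Variables (R : realType) (n : option nat) (E Es : hilbertType R).
Variable Theta : bop (fock n E) (fock n Es).
Hypotheses (Tc : contractive Theta) (Tm : multi_analytic Theta).

(** The residual part of an invariant subspace has no Fock component. Its vectors
are limits of sums of vectors [dilation i m], whose Fock component has no
constant term; and deleting the first letter of a word amounts to applying the
adjoint of a dilation, which preserves the residual part. *)
Lemma residual_hfst (M : set (ambient Theta)) (F : hilbertType R)
    (Psi : bop (fock n F) (ambient Theta)) :
  (forall m, M m -> adj Psi m = 0 ->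
    (orth (orth (shift_images (dilation Theta) M)) : set _) m /\
    (forall i, M (adj (dilation Theta i) m) /\ adj Psi (adj (dilation Theta i) m) = 0)) ->
  forall m, M m -> adj Psi m = 0 -> hfst m = 0.
Proof.
move=> MP m Mm Pm; apply/val_inj/funext => w; rewrite /=.
elim: w m Mm Pm => [|i w IH] m Mm Pm.
  have [mV _] := MP m Mm Pm.
  apply: inner_ext => l; rewrite inner0l -inner_tensor.
  have : inner m (HSum (fock_tensor [::] l) 0) = 0.
    apply: mV => _ [i [m' [_ ->]]]; apply: inner_sym0.
    rewrite hsum_innerr inner0r addr0 hfst_dilation inner_tensor.
    exact: inner0l.
  by rewrite hsum_innerr inner0r addr0.
have [_ /(_ i)[VMm VPm]] := MP m Mm Pm.
have := IH _ VMm VPm; rewrite adj_dilationE.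
by rewrite -[hfst (HSum _ _)]/(adj (create Es i) (hfst m)) adj_create.
Qed.

(** Split [M] by Wold into [range Psi] and a residual part [U], which lies in the
defect space of [Theta]. Then [Theta2] is the Fock component of [Psi] and [Theta1]
is [adj Psi] on the graph of [Theta]. The other component [Gam] of [Psi] and the
residual component [Gam'] of the graph have the norms of [defect_map Theta2] and
[defect_map Theta1], so they define isometries [W] and [W'] of the defect spaces of
[Theta2] and [Theta1] into that of [Theta]. Their ranges are orthogonal and contain
[defect_map Theta g = Gam (Theta1 g) + Gam' g] in their sum, whence
[Z = W + W'] is onto and inverse to the map [X] of the factorization. *)
Lemma dilation_invariant_factor (M : set (ambient Theta)) :
  closed_subspace M -> graph (Theta := Theta) `<=` M ->
  (forall i x, M x -> M (dilation Theta i x)) ->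
  exists (F : hilbertType R) (Theta2 : bop (fock n F) (fock n Es))
         (Theta1 : bop (fock n E) (fock n F)),
    regular_factorization Theta Theta2 Theta1 /\ factor_range Theta Theta2 Theta1 = M.
Proof.
move=> Mcs GM VM.
have [M0 MD Mcl] := Mcs.
have [iota [iE ii iV]] := graph_embedding Tc Tm.
have [F [Psi [PP MPsi PS PV MP]]] := wold (dilation_row Tc Tm) Mcs VM.
have Mu := residual_hfst MP.
have Miota g : M (iota g) by apply: GM; exists g => //; rewrite iE.
have [p1 p1E] := hfst_exists (fock n Es) (defect_space Theta).
have [p2 p2E] := hsnd_exists (fock n Es) (defect_space Theta).
have [Th2 Th2E] := comp_exists p1 Psi.
have [Gam GamE] := comp_exists p2 Psi.
have [Th1 Th1E] := comp_exists (adj Psi) iota.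
have [PTh1 PTh1E] := comp_exists Psi Th1.
have [Res ResE] := sub_exists iota PTh1.
have [Gam' Gam'E] := comp_exists p2 Res.
have PsiE f : Psi f = HSum (Th2 f) (Gam f).
  by apply: hsum_ext; rewrite ?Th2E ?GamE ?p1E ?p2E.
have Pin f g : inner (Psi f) (Psi g) = inner f g by rewrite adjP PP.
have ResP g : adj Psi (Res g) = 0.
  by rewrite ResE PTh1E linearB /= PP Th1E subrr.
have MRes g : M (Res g).
  by rewrite ResE PTh1E addrC -scaleN1r; apply: MD.
have Res1 g : hfst (Res g) = 0 := Mu _ (MRes g) (ResP g).
have ResHS g : Res g = HSum 0 (Gam' g).
  by apply: hsum_ext; rewrite ?Res1 ?Gam'E ?p2E.
have ResIn g h : inner (Res g) (Res h) = inner g h - inner (Th1 g) (Th1 h).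
  have oPR f : inner (Psi f) (Res h) = 0 by rewrite adjP ResP inner0r.
  rewrite {1}ResE innerBl PTh1E oPR subr0 ResE innerBr PTh1E ii.
  by rewrite adjPr -Th1E.
have Th2c : contractive Th2.
  by move=> f; rewrite ler_norm_inner -Pin !PsiE hsum_innerE lerDl inner_ge0.
have Th1c : contractive Th1.
  by move=> g; rewrite ler_norm_inner -subr_ge0 -ResIn inner_ge0.
have Th2m : multi_analytic Th2.
  by move=> i f; rewrite !Th2E !p1E PS hfst_dilation.
have Th1m : multi_analytic Th1.
  by move=> i g; rewrite !Th1E -iV PV.
have fact f : Theta f = Th2 (Th1 f).
  have := Res1 f; rewrite ResE PTh1E iE PsiE => /eqP.
  by rewrite -[hfst _]/(Theta f - Th2 (Th1 f)) subr_eq0 => /eqP.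
have DeltaE g : defect_map Theta g = Gam (Th1 g) + Gam' g.
  have : iota g = Psi (Th1 g) + Res g by rewrite ResE PTh1E addrC subrK.
  rewrite iE PsiE ResHS => /(congr1 (@hsnd _ _ _)).
  by [].
have [|W [WE Win]] := isometry_extend_inner (B := Gam) (@defect_map_linear _ _ _ Th2)
    (@defect_map_dense _ _ _ Th2).
  move=> x y; rewrite defect_map_inner// -Pin !PsiE hsum_innerE.
  by rewrite addrC addKr.
have [|W' [WE' Win']] := isometry_extend_inner (B := Gam') (@defect_map_linear _ _ _ Th1)
    (@defect_map_dense _ _ _ Th1).
  move=> x y; rewrite defect_map_inner// -ResIn !ResHS hsum_innerE.
  by rewrite inner0l add0r.
have WW a b : inner (W a) (W' b) = 0.
  apply: (orth_dense (@defect_map_dense _ _ _ Th2) (@defect_map_dense _ _ _ Th1)).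
  move=> f g; rewrite WE WE'.
  have : inner (Psi f) (Res g) = 0 by rewrite adjP ResP inner0r.
  by rewrite PsiE ResHS hsum_innerE inner0r add0r.
have [Z ZE] := sum_exists W W'.
have ZZ p q : inner (Z p) (Z q) = inner p q.
  rewrite !ZE innerDl !innerDr WW (inner_sym0 (WW _ _)) addr0 add0r Win Win'.
  by rewrite hsum_inner.
pose X := factor_map Theta Th2 Th1.
have XE := factor_mapP Tc Th1c Th2c fact.
(* It is enough to see this on the range of [defect_map Theta], by [DeltaE]. *)
have ZX u : Z (X u) = u.
  have [ZX ZXE] := comp_exists Z X.
  have [Id IdE] := id_exists (defect_space Theta).
  rewrite -ZXE -[RHS]IdE.
  apply: (bop_eq_dense (S := range (defect_map Theta))); last exact: defect_map_dense.
  move=> _ [g _ <-]; rewrite ZXE IdE XE ZE.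
  by rewrite -[hfst _]/(defect_map Th2 (Th1 g)) -[hsnd _]/(defect_map Th1 g)
    WE WE' -DeltaE.
have [Xu aX] := isometry_left_inverse ZZ ZX.
have range_elt f d :
    HSum (Th2 f) (adj X (HSum (defect_map Th2 f) d)) = Psi f + HSum 0 (W' d).
  rewrite aX ZE -[hfst (HSum _ _)]/(defect_map Th2 f) -[hsnd (HSum _ _)]/d WE PsiE.
  by rewrite -[RHS]/(HSum (Th2 f + 0) (Gam f + W' d)) addr0.
exists F, Th2, Th1; split; first by split.
apply/seteqP; split=> [_ [f _ [d _ <-]]|m Mm].
  rewrite range_elt -[Psi f]scale1r; apply: MD; first exact: MPsi.
  rewrite -(orthK Mcs) => y yM; rewrite hsum_inner inner0l add0r adjP.
  move: d; apply: defect_map_orth => g; rewrite -adjP WE'.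
  by have := inner_sym0 (yM _ (MRes g)); rewrite ResHS hsum_inner inner0l add0r.
pose f := adj Psi m; pose r := m - Psi f.
have rP : adj Psi r = 0 by rewrite linearB /= PP subrr.
have Mr : M r by rewrite /r addrC -scaleN1r; apply: MD.
have r1 : hfst r = 0 := Mu _ Mr rP.
pose u := hsnd r.
(* [u] is in the residual part, so it lies in the range of [W'] alone. *)
have uW a : inner (W a) u = 0.
  rewrite adjP; move: a; apply: defect_map_orth => f'.
  rewrite -adjP WE.
  have : inner (Psi f') r = 0 by rewrite adjP rP inner0r.
  by rewrite PsiE hsum_inner r1 inner0r add0r.
have uE : u = W' (hsnd (X u)).
  have := ZX u; rewrite ZE; set a := hfst _; set b := hsnd _ => ab.
  have Wa0 : W a = 0.
    apply: inner_eq0; rewrite -[X in inner _ X](addrK (W' b)) ab.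
    by rewrite innerBr uW WW subrr.
  by rewrite -ab Wa0 add0r.
exists f => //; exists (hsnd (X u)) => //; rewrite range_elt -uE.
rewrite -[RHS](subrK (Psi f)) addrC; congr (_ + _).
by apply: hsum_ext.
Qed.

End forward.

(** * The correspondence *)

Theorem theorem3p3 (R : realType) (n : option nat) (n_pos : n != Some 0%N)
    (E Es : hilbertType R) (Theta : bop (fock n E) (fock n Es)) :
  contractive Theta -> multi_analytic Theta -> purely_contractive Theta ->
  closure (range (defect Theta)) =
    closure (defect Theta @` ominus setT (range (@vacuum R (letter n) E))) ->
  (forall H1 : set (ambient Theta), invariant_subspace Theta H1 ->
     exists (F : hilbertType R) (Theta2 : bop (fock n F) (fock n Es))
            (Theta1 : bop (fock n E) (fock n F)),
       [/\ regular_factorization Theta Theta2 Theta1,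
           H1 = factor_space1 Theta Theta2 Theta1 &
           ominus (model_space Theta) H1 = factor_space2 Theta Theta2 Theta1])
  /\
  (forall (F : hilbertType R) (Theta2 : bop (fock n F) (fock n Es))
          (Theta1 : bop (fock n E) (fock n F)),
     regular_factorization Theta Theta2 Theta1 ->
     invariant_subspace Theta (factor_space1 Theta Theta2 Theta1) /\
     factor_space2 Theta Theta2 Theta1 =
       ominus (model_space Theta) (factor_space1 Theta Theta2 Theta1)).
Proof.
move=> Tc Tm _ _; split=> [H1 H1inv|F Theta2 Theta1].
  have [H1cs H1m _] := H1inv.
  pose N := ominus (model_space Theta) H1.
  have Ncs : closed_subspace N by apply: ominus_closed; exact: subspace_closed.
  have GN : graph (Theta := Theta) `<=` (orth N : set _).
    by move=> g Gg y [yG _]; exact/inner_sym0/yG.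
  have [F [Theta2 [Theta1 [reg rangeE]]]] := dilation_invariant_factor Tc Tm
    (subspace_closed (orth N)) GN (invariant_dilation Tc Tm H1inv).
  have [[T1c T1m] [T2c T2m] fact Xu] := reg.
  exists F, Theta2, Theta1; split=> //.
    by rewrite -[LHS](ominus_orth_ominus H1cs H1m) -rangeE.
  by rewrite [RHS]factor_space2E// rangeE [RHS]orthK.
move=> [[T1c T1m] [T2c T2m] fact Xu].
have Mcs := factor_range_closed T2c Xu.
have GM := graph_factor_range Tc T1c T2c fact Xu.
split.
  apply: (invariant_ominus_graph Tc Tm Mcs GM) => i x.
  exact: factor_range_dilation.
by rewrite [LHS]factor_space2E// [RHS]ominus_ominus.
Qed.
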